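(* Let $d=1$, $r\in[2,\infty)$, $s=r/(r-1)$, and let $\Lambda:L^r(\Omega)\rightrightarrows L^s(\Omega)$ be a dissipative drag operator (with associated $\mathbb{D},\Phi,\Psi$). Then the following problem has a solution: find $(u,p)\in L^r(\Omega)\times W_0^{1,s}(\Omega)$ such that there exists $\lambda\in\Lambda(u)$ with $$\langle\lambda,\varphi\rangle=\langle-p'+f_0,\varphi\rangle\quad\forall\varphi\in L^r(\Omega),\qquad \langle\psi',u\rangle=-\int_\Omega q\psi+\int_{\Sigma_{\mathrm v}}u_0\psi\quad\forall\psi\in W_0^{1,s}(\Omega).$$
   Context: Setting (dimension $d=1$). $\Omega\subset\mathbb{R}$ is open, bounded, with Lipschitz boundary $\partial\Omega$ (the one-dimensional porous medium). $\Sigma_{\mathrm v},\Sigma_{\mathrm p}\subset\partial\Omega$ are relatively open in $\partial\Omega$, with $\partial\Omega=\overline{\Sigma_{\mathrm v}\cup\Sigma_{\mathrm p}}$ and $\Sigma_{\mathrm v}\cap\Sigma_{\mathrm p}=\emptyset$. $\mathrm{Vol}^0$ is the $0$-dimensional (counting) measure, used for integrals over $\Sigma_{\mathrm v}$. $\|\cdot\|_\beta$ is the norm of $L^\beta(\Omega)$; $\langle\cdot,\cdot\rangle$ is the canonical dual pairing on $L^s(\Omega)\times L^r(\Omega)$; $\mathbb{R}_+=[0,\infty)$. Data: $q\in L^r(\Omega)$, $f\in L^s(\Omega)$, $u_0\in L^r(\Sigma_{\mathrm v})$, $p_0\in W^{\frac1r,s}(\Sigma_{\mathrm p})$. $f_0=f$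 if $\mathrm{Vol}^0(\Sigma_{\mathrm p})=0$, and $f_0=f-(Ep_0)'$ if $\mathrm{Vol}^0(\Sigma_{\mathrm p})>0$, where $E$ is any extension operator from data on $\Sigma_{\mathrm p}$ to $W^{1,s}(\Omega)$ that is a right inverse of the trace operator. $W_0^{1,s}(\Omega)=\{\xi\in W^{1,s}(\Omega):\frac1{|\Omega|}\int_\Omega\xi=0\}$ if $\mathrm{Vol}^0(\Sigma_{\mathrm p})=0$, and $W_0^{1,s}(\Omega)=\{\xi\in W^{1,s}(\Omega):\xi=0\text{ on }\Sigma_{\mathrm p}\}$ if $\mathrm{Vol}^0(\Sigma_{\mathrm p})>0$, normed by $\psi\mapsto\|\psi'\|_s$. Dissipative drag operator ($d=1$). $\mathbb{D}:\Omega\to(0,\infty)$ satisfies $\sup\mathbb{D}<\infty$ and $\inf\mathbb{D}>0$; $\|u\|_{\mathbb{D}}^2$ is the function $x\mapsto\mathbb{D}(x)u(x)^2$. The multivalued map $\Phi:\mathbb{R}_+\rightrightarrows\mathbb{R}_+$ is nonempty-valued and set-continuous (if $a_n\to a$, there are $\phi_n\in\Phi(a_n)$ converging to an element of $\Phi(a)$), and there are $c,C>0$ with $c\,a^{\frac{r-2}2}\leq\phi\leq C(1+a^{\frac{r-2}2})$ whenever $a\geq0$ and $\phi\in\Phi(a)$. $\Psi:\mathbb{R}_+\to\mathbb{R}$ is locally Lipschitz with Clarke subdifferential $\partial\Psi=\Phi$. The operator is $\Lambda(u)=\Phi(\|u\|_{\mathbb{D}}^2)\,\mathbb{D}u$,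 i.e. the set of $\lambda\in L^s(\Omega)$ with $\lambda(x)=\phi(x)\mathbb{D}(x)u(x)$, $\phi(x)\in\Phi(\mathbb{D}(x)u(x)^2)$ for a.e. $x$; it is assumed nonempty for all $u$.
   Formalization: The formal theorem assumes explicitly that ψ ↦ ‖ψ'‖_s really is a norm on W_0^{1,s}(Ω); this can fail for disconnected Ω (e.g. two intervals with Σ_p empty), where the claim is false in general. *)

(* Defs.v *)
From mathcomp Require Export all_boot all_order all_algebra.
From mathcomp Require Export all_classical all_reals all_analysis.

Set Implicit Arguments.
Unset Strict Implicit.
Unset Printing Implicit Defensive.

Import Order.TTheory GRing.Theory Num.Theory.
Import numFieldNormedType.Exports.

Local Open Scope classical_set_scope.
Local Open Scope ring_scope.

(* A function on a subset of the line is represented by a total function     *)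
(* R -> R whose values outside the subset are never used.                    *)

Section Domain.
Context {R : realType}.
Implicit Types (Om A : set R).

Definition boundary A : set R := closure A `\` A°.

(* In dimension one the local graph condition compares y with a constant:    *)
(* near each boundary point x, Om is exactly one of the two sides of x.      *)
Definition lipschitz_boundary Om :=
  forall x, boundary Om x -> exists2 e : R, 0 < e &
    (forall y, ball x e y -> (Om y <-> x < y)) \/
    (forall y, ball x e y -> (Om y <-> y < x)).

Definition relatively_open A B := exists2 U : set R, open U & A = U `&` B.

End Domain.

Section FunctionSpaces.
Context {R : realType}.
Implicit Types (Om Sp : set R) (psi dpsi tau : R -> R).

Definition Vol1 : {measure set (measurableTypeR R) -> \bar R} :=
  lebesgue_measure.

Definition Vol0 : {measure set (measurableTypeR R) -> \bar R} := counting.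

(* u \_ A is the extension of u by 0 outside A (point = 0 in R).             *)
Definition Lp (mu : {measure set (measurableTypeR R) -> \bar R})
    (A : set R) (p : R) (u : R -> R) : Prop :=
  (u \_ A : measurableTypeR R -> R) \in Lfun mu p%:E.

Definition Lpnorm (A : set R) (p : R) (u : R -> R) : \bar R :=
  'N[Vol1]_(p%:E)[EFin \o (u \_ A)].

Definition pairing (A : set R) (f g : R -> R) : R :=
  \int[Vol1]_(x in A) (f x * g x).

Definition test_function Om (phi : R -> R) :=
  [/\ forall n x, derivable (derive1n n phi) x 1,
      compact (closure [set x | phi x != 0]) &
      closure [set x | phi x != 0] `<=` Om].

(* psi belongs to W^{1,p}(Om) and dpsi represents its weak derivative psi';  *)
(* dpsi is determined by psi up to equality a.e. on Om.                      *)
Definition sobolev_deriv Om (p : R) psi dpsi :=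
  [/\ Lp Vol1 Om p psi, Lp Vol1 Om p dpsi &
      forall phi, test_function Om phi ->
        pairing Om psi (derive1 phi) = - pairing Om dpsi phi].

Definition W1 Om (p : R) psi := exists dpsi, sobolev_deriv Om p psi dpsi.

(* The boundary values of psi, via its representative that is continuous up  *)
(* to the boundary; only the values of tau on the boundary are constrained.  *)
Definition is_trace Om psi tau :=
  exists h : R -> R,
    [/\ {within closure Om, continuous h},
        {ae Vol1, forall x, Om x -> psi x = h x} &
        forall x, boundary Om x -> tau x = h x].

Definition zero_trace Om Sp psi :=
  exists2 tau, is_trace Om psi tau & forall x, Sp x -> tau x = 0.

Definition W10 Om Sp (p : R) psi :=
  [/\ W1 Om p psi,
      Vol0 Sp = 0%E -> (fine (Vol1 Om))^-1 * \int[Vol1]_(x in Om) psi x = 0 &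
      (0 < Vol0 Sp)%E -> zero_trace Om Sp psi].

(* Sobolev-Slobodeckij space W^{sigma,p}(Sp) over the 0-dimensional set Sp:  *)
(* the exponent of |x - y| is 0 + sigma * p, and the terms x = y contribute  *)
(* 0 because 0^-1 = 0.                                                       *)
Definition Wfrac Sp (sigma p : R) (g : R -> R) :=
  Lp Vol0 Sp p g /\
  (\int[Vol0]_(x in Sp) \int[Vol0]_(y in Sp)
     (`|g x - g y| `^ p / `|x - y| `^ (sigma * p))%:E < +oo)%E.

Definition extension_operator Om Sp (r p : R) (E : (R -> R) -> R -> R) :=
  forall g, Wfrac Sp r^-1 p g ->
    W1 Om p (E g) /\
    exists2 tau, is_trace Om (E g) tau & forall x, Sp x -> tau x = g x.

(* dEp0 stands for (E p0)'.                                                  *)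
Definition forcing Sp (f dEp0 : R -> R) : R -> R :=
  if Vol0 Sp == 0%E then f else fun x => f x - dEp0 x.

End FunctionSpaces.

Section Drag.
Context {R : realType}.
Implicit Types (D u lam Psi : R -> R) (Phi : R -> set R) (Om : set R).

Definition set_continuous_nneg Phi :=
  forall (a : R) (a_ : nat -> R), 0 <= a -> (forall n, 0 <= a_ n) ->
    a_ n @[n --> \oo] --> a ->
    exists phi_ : nat -> R, (forall n, Phi (a_ n) (phi_ n)) /\
      exists2 l, Phi a l & phi_ n @[n --> \oo] --> l.

Definition locally_lipschitz_nneg Psi :=
  forall a : R, 0 <= a -> exists2 U : set R, nbhs a U &
    [lipschitz Psi x | x in U `&` [set x | 0 <= x]].

(* Clarke's generalized directional derivative of a function defined on      *)
(* [0, +oo): limsup of (Psi (y + t v) - Psi y) / t as y -> a and t -> 0+     *)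
(* with both y and y + t v in [0, +oo). The last restriction is void near    *)
(* any a > 0.                                                                *)
Definition clarke_deriv Psi (a v : R) : \bar R :=
  limf_esup (fun yt : R * R => ((Psi (yt.1 + yt.2 * v) - Psi yt.1) / yt.2)%:E)
    (within [set yt : R * R | [/\ 0 <= yt.1, 0 < yt.2 & 0 <= yt.1 + yt.2 * v]]
       (nbhs (a, 0 : R))).

Definition clarke_subdiff Psi (a : R) : set R :=
  [set xi | forall v, ((xi * v)%:E <= clarke_deriv Psi a v)%E].

Definition drag D Phi Om (s : R) u lam :=
  Lp Vol1 Om s lam /\
  {ae Vol1, forall x, Om x ->
     exists2 phi, Phi (D x * u x ^+ 2) phi & lam x = phi * (D x * u x)}.

Record dissipative_drag Om (r s : R) D Phi Psi : Prop := DissipativeDrag {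
  drag_coef_gt0 : forall x, Om x -> 0 < D x;
  drag_coef_sup : (ereal_sup [set (D x)%:E | x in Om] < +oo)%E;
  drag_coef_inf : (0 < ereal_inf [set (D x)%:E | x in Om])%E;
  drag_map_nonempty : forall a, 0 <= a -> Phi a !=set0;
  drag_map_ge0 : forall a phi, 0 <= a -> Phi a phi -> 0 <= phi;
  drag_map_continuous : set_continuous_nneg Phi;
  drag_map_growth : exists c C : R, [/\ 0 < c, 0 < C &
    forall a phi, 0 <= a -> Phi a phi ->
      c * a `^ ((r - 2) / 2) <= phi <= C * (1 + a `^ ((r - 2) / 2))];
  drag_potential_lipschitz : locally_lipschitz_nneg Psi;
  drag_potential_subdiff : forall a, 0 <= a -> clarke_subdiff Psi a = Phi a;
  drag_nonempty : forall u, Lp Vol1 Om r u -> exists lam, drag D Phi Om s u lam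
}.

End Drag.

(* Main.v *)
(* In dimension one Om is a finite union of intervals ]a, b[ with disjoint
   closures, and the second equation says that on each of them u' = q + k
   together with u = - u0 at a left end and u = u0 at a right end in Sv, where
   k = 0 unless Sp is empty.  Applied to locally constant functions, the norm
   hypothesis shows that every component has an end in Sp, or that Sp is empty
   and there is at most one component.  Hence u is determined by the data, except
   for an additive constant on a component with both ends in Sp.  The pressure
   is a primitive of f_0 - lam, and only on such a component do its two boundary
   values impose a condition, namely that the integral of lam is prescribed.
   This is solved for the additive constant c by an intermediate value argument:
   lam in Lambda (c + Q) has integral tending to +oo or -oo with c, the graph of
   Phi is closed because Phi is a Clarke subdifferential (so lower limits of
   selections are selections), and its values are convex. *)

(* [Phi] may be multivalued and need not be monotone, so the integral of a selection of Lambda (c +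
   Q) need be neither monotone nor continuous in c. The intermediate value argument takes c0 as the
   supremum of the c that admit a selection with integral at most m. Approximating c0 from below and
   from above yields two selections at the same c0 whose integrals lie on either side of m, and
   convexity joins them. The obstacle is measurability of the limit: subsequences chosen separately
   at each point give no measurable function, whereas the lower limit of bounded measurable
   selections is measurable and is a cluster value at every point. It preserves upper bounds of the
   integral; lower bounds follow because the drag is odd in u.

   Test functions psi have weak derivatives only, and traces through some continuous representative.
   Smooth cutoffs are built by hand to show that this representative is a primitive of the weak
   derivative up to the boundary. Both equations then reduce to integration by parts on closed
   intervals, where Fubini's theorem replaces the product rule. *)
Require Import Defs.
From mathcomp Require Import ring lra measurable_realfun.
Import Order.TTheory GRing.Theory Num.Theory.
Import numFieldNormedType.Exports.

Local Open Scope classical_set_scope.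
Local Open Scope ring_scope.

Set Implicit Arguments.
Unset Strict Implicit.
Unset Printing Implicit Defensive.

(** * Smooth cutoff functions *)

Section SmoothStep.
Context {R : realType}.
Implicit Types (f g phi : R -> R) (t x y : R).

(** The flat function $e^{-1/t}$ together with the factors $t^{-n}$ that its derivatives produce;
    keeping n as a parameter makes the linear span of the family closed under differentiation. *)
Definition expinv (n : nat) t : R :=
  if 0 < t then t^-1 ^+ n * expR (- t^-1) else 0.

Lemma expinv_ge0 n t : 0 <= expinv n t.
Proof.
rewrite /expinv; case: ifP => // t0.
by rewrite mulr_ge0 ?expR_ge0// exprn_ge0// invr_ge0 ltW.
Qed.

(** With $y = 1/t$, the exponential series dominates its term of degree n+1, so $y^n e^{-y} \le
    (n+1)!/y$. This decay gives differentiability at 0. *)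
Lemma expinv_le n t : 0 < t -> expinv n t <= n.+1`!%:R * t.
Proof.
move=> t0; rewrite /expinv t0 expRN.
have y0 : 0 < t^-1 by rewrite invr_gt0.
have := expR_ge1Dxn n (ltW y0).
set y := t^-1 in y0 *; set F := n.+1`!%:R => h.
have F0 : 0 < F by rewrite ltr0n fact_gt0.
have {}h : y ^+ n.+1 / F <= expR y by apply: le_trans h; rewrite lerDr.
rewrite ler_pdivrMr ?expR_gt0//.
have -> : t = y^-1 by rewrite invrK.
rewrite -mulrA -ler_pdivrMl// ler_pdivlMl//.
by apply: le_trans h; rewrite mulrCA -exprS mulrC.
Qed.

Lemma is_derive_expinv n t :
  is_derive t 1 (expinv n) (- n%:R * expinv n.+1 t + expinv n.+2 t).
Proof.
have [t0|t0|->] := ltgtP t 0.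
- have E : \forall x \near t, cst 0 x = expinv n x.
    near=> x; rewrite /expinv ifF//; apply/negbTE; rewrite -leNgt ltW//.
    by near: x; exact: lt_nbhsl.
  have -> : - n%:R * expinv n.+1 t + expinv n.+2 t = 0.
    by rewrite /expinv !ifF ?(lt_gtF t0)// mulr0 addr0.
  apply: (near_eq_is_derive E); exact: is_derive_cst.
- have E : \forall x \near t, (fun x => x^-1 ^+ n * expR (- x^-1)) x = expinv n x.
    near=> x; rewrite /expinv ifT//.
    by near: x; exact: lt_nbhsr.
  apply: (near_eq_is_derive E).
  rewrite /expinv !t0.
  have tn0 : t != 0 by rewrite gt_eqF.
  have dV : is_derive t 1 (fun x : R => x^-1) (- t^-1 ^+ 2).
    have := @is_deriveV _ id t 1 1 tn0 _.
    by rewrite /GRing.scale/= mulr1 -exprVn; apply; exact: is_derive_id.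
  have dN : is_derive t 1 (fun x : R => - x^-1) (t^-1 ^+ 2).
    by have := is_deriveN dV; rewrite opprK.
  have dX : is_derive t 1 (fun x : R => x^-1 ^+ n) (n%:R * t^-1 ^+ n.-1 * (- t^-1 ^+ 2)).
    have := is_deriveX n dV; rewrite /GRing.scale/=.
    by congr is_derive; apply/funext => x; rewrite exprfctE.
  have dE : is_derive t 1 (fun x => expR (- x^-1)) (expR (- t^-1) * t^-1 ^+ 2).
    exact: (is_derive1_comp _ dN).
  have := is_deriveM dX dE; rewrite /GRing.scale/=.
  congr is_derive; case: (n) => [|m] /=.
    by rewrite !mul0r expr0 mulr0 addr0 oppr0 mul0r add0r mul1r mulrC.
  by rewrite !exprS expr0; ring.
- suff H : is_derive (0 : R) 1 (expinv n) 0.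
    by rewrite /expinv ltxx mulr0 addr0.
  have K : h^-1 *: ((expinv n \o shift 0) (h *: 1) - expinv n 0) @[h --> 0^'] --> (0 : R).
    apply/cvgrPdist_le => e e0; near=> h.
    rewrite /= addr0 /GRing.scale/= mulr1 {2}/expinv ltxx subr0 sub0r normrN.
    have hn : h != 0 by near: h; exact: nbhs_dnbhs_neq.
    have [h0|h0] := ltP 0 h; last first.
      by rewrite /expinv ifF ?mulr0 ?normr0 ?ltW// ltNge h0.
    rewrite ger0_norm ?mulr_ge0 ?expinv_ge0 ?invr_ge0 ?(ltW h0)//.
    (* The difference quotient at 0 is the next member of the family, which is O(h) by
       [expinv_le]. *)
    have -> : h^-1 * expinv n h = expinv n.+1 h.
      by rewrite /expinv h0 exprS mulrA.
    have /le_trans := expinv_le n.+1 h0; apply.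
    rewrite -ler_pdivlMl ?ltr0n ?fact_gt0//.
    have : `|h| < (n.+2`!%:R)^-1 * e.
      near: h; apply: dnbhs0_lt; rewrite mulr_gt0 ?invr_gt0 ?ltr0n ?fact_gt0//.
    by move=> /ltW; rewrite ger0_norm ?(ltW h0).
  apply: DeriveDef; first by apply/cvg_ex; exists 0.
  exact/cvg_lim.
Unshelve. all: by end_near. Qed.

(* Closed under differentiation, so that smooth functions are infinitely
   differentiable; see [smooth_derive1n]. *)
Inductive smooth : (R -> R) -> Prop :=
| smooth_expinv n a b : smooth (fun x => expinv n (a * x + b))
| smooth_cst c : smooth (fun=> c)
| smoothD f g : smooth f -> smooth g -> smooth (fun x => f x + g x)
| smoothM f g : smooth f -> smooth g -> smooth (fun x => f x * g x)
| smoothV f : smooth f -> (forall x, f x != 0) -> smooth (fun x => (f x)^-1).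

Lemma smooth_is_derive f : smooth f ->
  exists2 df, smooth df & forall x, is_derive x 1 f (df x).
Proof.
elim=> {f} [n a b|c|f g _ [df sf Df] _ [dg sg Dg]
           |f g sf0 [df sf Df] sg0 [dg sg Dg]|f sf0 [df sf Df] f0].
- exists (fun x => a * (- n%:R * expinv n.+1 (a * x + b) + expinv n.+2 (a * x + b))).
    by apply: smoothM; [exact: smooth_cst|apply: smoothD; [apply: smoothM|];
      [exact: smooth_cst|exact: smooth_expinv..]].
  move=> x.
  have aff : is_derive x 1 (fun x : R => a * x + b) a.
    have H := @is_deriveD _ _ _ (fun x : R => a * x) (cst b) x 1 a 0 _ (is_derive_cst _ _ _).
    rewrite addr0 in H; apply: H.
    by have := is_deriveZ a (is_derive_id x 1); rewrite /GRing.scale/= mulr1.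
  rewrite mulrC; exact: (is_derive1_comp (is_derive_expinv n _) aff).
- exists (fun=> 0); first exact: smooth_cst.
  by move=> x; exact: is_derive_cst.
- exists (fun x => df x + dg x); first exact: smoothD.
  by move=> x; exact: (is_deriveD (Df x) (Dg x)).
- exists (fun x => f x * dg x + g x * df x).
    by apply: smoothD; exact: smoothM.
  by move=> x; exact: (is_deriveM (Df x) (Dg x)).
- exists (fun x => -1 * ((f x)^-1 * (f x)^-1) * df x).
    by apply: smoothM => //; apply: smoothM; [exact: smooth_cst|apply: smoothM; exact: smoothV].
  move=> x; have := is_deriveV (f0 x) (Df x).
  by rewrite /GRing.scale/= -exprVn mulN1r.
Qed.

Lemma smooth_derive1 f : smooth f -> smooth (derive1 f).
Proof.
move=> /smooth_is_derive[df sdf Df].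
suff -> : derive1 f = df by [].
by apply/funext => x; rewrite derive1E; apply: derive_val.
Qed.

Lemma smooth_derivable f x : smooth f -> derivable f x 1.
Proof. by move=> /smooth_is_derive[df _ Df]; have [] := Df x. Qed.

Lemma smooth_derive1n f n : smooth f -> smooth (derive1n n f).
Proof. by move=> sf; elim: n => [//|n ih]; rewrite derive1nS; exact: smooth_derive1. Qed.

Lemma smooth_continuous f : smooth f -> continuous f.
Proof.
move=> sf x; apply: differentiable_continuous.
by apply/derivable1_diffP; exact: smooth_derivable.
Qed.

Lemma smooth_affine f a b : smooth f -> smooth (fun x => f (a * x + b)).
Proof.
elim=> {f} [n c d|c|f g _ sf _ sg|f g _ sf _ sg|f _ sf f0].
- rewrite (_ : (fun _ => _) = fun x => expinv n (c * a * x + (c * b + d))).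
    exact: smooth_expinv.
  by apply/funext => x; congr expinv; ring.
- exact: smooth_cst.
- exact: smoothD.
- exact: smoothM.
- by apply: smoothV.
Qed.

(** The classical smooth transition from 0 (for t <= 0) to 1 (for t >= 1). The denominator is
    positive because t and 1 - t are never both nonpositive. *)
Definition step t : R := expinv 0 t * (expinv 0 t + expinv 0 (1 - t))^-1.

Lemma expinv0_gt0 t : 0 < t -> 0 < expinv 0 t.
Proof. by move=> t0; rewrite /expinv t0 expr0 mul1r expR_gt0. Qed.

Lemma step_den_gt0 t : 0 < expinv 0 t + expinv 0 (1 - t).
Proof.
have [t0|t0] := ltP 0 t.
  by rewrite ltr_pwDl ?expinv_ge0 ?expinv0_gt0.
by rewrite ltr_wpDl ?expinv_ge0 ?expinv0_gt0// subr_gt0 (le_lt_trans t0).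
Qed.

Lemma smooth_step : smooth step.
Proof.
have e1 : smooth (expinv 0).
  rewrite (_ : expinv 0 = fun x => expinv 0 (1 * x + 0)); first exact: smooth_expinv.
  by apply/funext => x; rewrite mul1r addr0.
apply: smoothM => //; apply: smoothV => [|x]; last by rewrite gt_eqF// step_den_gt0.
apply: smoothD => //.
rewrite (_ : (fun _ => _) = fun x => expinv 0 ((-1) * x + 1)); first exact: smooth_expinv.
by apply/funext => x; rewrite mulN1r addrC.
Qed.

Lemma step_ge0 t : 0 <= step t.
Proof. by rewrite mulr_ge0 ?expinv_ge0// invr_ge0 ltW// step_den_gt0. Qed.

Lemma step_le1 t : step t <= 1.
Proof. by rewrite ler_pdivrMr ?step_den_gt0// mul1r lerDl expinv_ge0. Qed.

Lemma step_le0 t : t <= 0 -> step t = 0.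
Proof. by move=> t0; rewrite /step {1}/expinv ltNge t0/= mul0r. Qed.

Lemma step_ge1 t : 1 <= t -> step t = 1.
Proof.
move=> t1; rewrite /step {3}/expinv ltNge subr_le0 t1/= addr0 divff// gt_eqF//.
by rewrite expinv0_gt0// (lt_le_trans _ t1).
Qed.

Lemma derive1_step_out t : t < 0 \/ 1 < t -> derive1 step t = 0.
Proof.
move=> t01; rewrite derive1E; apply: derive_val.
have [c E] : exists c : R, \forall x \near t, cst c x = step x.
  case: t01 => t0.
    exists 0; near=> x; rewrite step_le0// ltW//; near: x; exact: lt_nbhsl.
  exists 1; near=> x; rewrite step_ge1// ltW//; near: x; exact: lt_nbhsr.
by apply: (near_eq_is_derive E); exact: is_derive_cst.
Unshelve. all: by end_near. Qed.

(** The derivative is continuous and vanishes off [0, 1]. After rescaling by n+1 the bound becomes M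
    (n+1), as an approximate unit requires. *)
Lemma derive1_step_bounded : exists2 M : R, 0 < M & forall t, `|derive1 step t| <= M.
Proof.
have c : continuous (derive1 step) by exact/smooth_continuous/smooth_derive1/smooth_step.
have K := continuous_compact (continuous_subspaceT c) (@segment_compact R 0 1).
have [M [Mr HM]] := compact_bounded K.
exists (`|M| + 1); first by rewrite ltr_wpDl.
move=> t; have [t01|] := boolP (t \in `[0, 1]).
  apply: (HM (`|M| + 1)); first by rewrite (le_lt_trans (ler_norm _))// ltrDl.
  by exists t.
rewrite in_itv/= negb_and -!ltNge => /orP t01.
by rewrite derive1_step_out// normr0 addr_ge0.
Qed.

End SmoothStep.

(** * Absolutely continuous functions and integration by parts *)

Section Primitives.
Context {R : realType}.
Notation mu := (@lebesgue_measure R).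
Implicit Types (a b c : R) (f g h k w : R -> R).

Lemma bounded_on (D : set R) (h : R -> R) (M : R) :
  (forall x, D x -> `|h x| <= M) -> [bounded h x | x in D].
Proof.
by move=> hM; exists M; split=> [|y My x Dx]; rewrite ?num_real//= (le_trans (hM x Dx))// ltW.
Qed.

Lemma integrable_scaler (D : set (measurableTypeR R)) f c : measurable D ->
  mu.-integrable D (EFin \o f) -> mu.-integrable D (EFin \o (fun x => f x * c)).
Proof.
by move=> mD iF; exact: (integrableZr mD c iF).
Qed.

Lemma integrable_addR (D : set (measurableTypeR R)) f g : measurable D ->
  mu.-integrable D (EFin \o f) -> mu.-integrable D (EFin \o g) ->
  mu.-integrable D (EFin \o (fun x => f x + g x)).
Proof.
by move=> mD iF ig; exact: (integrableD mD iF ig).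
Qed.

Lemma integrable_patch (D : set (measurableTypeR R)) f : measurable D ->
  mu.-integrable D (EFin \o f) -> mu.-integrable setT (EFin \o (f \_ D)).
Proof.
by move=> mD fD; rewrite -restrict_EFin; exact: ((integrable_mkcond _ mD).1 fD).
Qed.

Lemma integrable_mfun (D : set (measurableTypeR R)) f :
  mu.-integrable D (EFin \o f) -> measurable_fun D f.
Proof. by move=> iD; apply/measurable_EFinP; exact: (measurable_int mu). Qed.

Lemma mem_itvcc a b x : (x \in `[a, b]%classic) = (a <= x <= b).
Proof. by apply/idP/idP; rewrite inE/= in_itv/=. Qed.

(** Both sides are the integral of g(x) k(t) over the triangle a <= t <= x <= b, taken in the two
    orders. *)
Lemma triangle_fubini a b g k :
  mu.-integrable `[a, b] (EFin \o g) -> mu.-integrable `[a, b] (EFin \o k) ->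
  \int[mu]_(x in `[a, b]) (g x * \int[mu]_(t in `[a, x]) k t) =
  \int[mu]_(t in `[a, b]) (k t * \int[mu]_(x in `[t, b]) g x).
Proof.
move=> ig ik; pose I := `[a, b]%classic : set (measurableTypeR R).
have mI : measurable I by exact: measurable_itv.
have iG : mu.-integrable setT (EFin \o (g \_ I)) by exact: integrable_patch.
have iK : mu.-integrable setT (EFin \o (k \_ I)) by exact: integrable_patch.
have mG := integrable_mfun iG.
have mK := integrable_mfun iK.
set G := g \_ I in iG mG; set K := k \_ I in iK mK.
(* Extending g and k by 0 lets Fubini be applied on the whole plane, with the triangle encoded by
   the condition t <= x alone. *)
pose F (p : measurableTypeR R * measurableTypeR R) : R :=
  if p.2 <= p.1 then G p.1 * K p.2 else 0.
have mF : measurable_fun setT F.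
  apply: measurable_fun_ifT => //.
    by apply: measurable_fun_ler; [exact: measurable_snd|exact: measurable_fst].
  by apply: measurable_funM; [exact: (measurableT_comp mG)|exact: (measurableT_comp mK)].
have iF : (mu \x mu)%E.-integrable setT (EFin \o F).
  apply/integrable12ltyP; first exact/measurable_EFinP.
  (* Tonelli: dropping the condition t <= x bounds the iterated integral of |F| by the product of
     the two $L^1$ norms. *)
  apply: (@le_lt_trans _ _ (\int[mu]_x (`|(G x)%:E| * \int[mu]_t `|(K t)%:E|))%E).
    apply: ge0_le_integral => //=.
    - by move=> x _; exact: integral_ge0.
    - apply: (@measurable_fun_fubini_tonelli_F _ _ _ _ _ mu (fun p => `|(F p)%:E|%E)) => //.
      by apply/measurable_EFinP; exact: measurableT_comp.
    - apply: emeasurable_funM => //.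
      by apply/measurable_EFinP; exact: measurableT_comp.
    - move=> x _; rewrite -ge0_integralZl//=; last first.
        by apply/measurable_EFinP; exact: measurableT_comp.
      apply: ge0_le_integral => //=.
      + apply/measurable_EFinP; apply: measurableT_comp => //.
        exact: (measurableT_comp mF).
      + apply/measurable_EFinP; apply: measurable_funM => //.
        exact: measurableT_comp.
      + move=> y _; rewrite /F/=; case: ifP => _; first by rewrite normrM.
        by rewrite normr0 mule_ge0.
  have fK : (\int[mu]_t `|(K t)%:E|)%E \is a fin_num.
    by rewrite ge0_fin_numE ?integral_ge0//; case/integrableP: iK.
  have fG : (\int[mu]_t `|(G t)%:E|)%E \is a fin_num.
    by rewrite ge0_fin_numE ?integral_ge0//; case/integrableP: iG.
  rewrite -(fineK fK) ge0_integralZr//=.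
  - by rewrite -(fineK fG) -EFinM ltry.
  - by apply/measurable_EFinP; exact: measurableT_comp.
  - by rewrite lee_fin fine_ge0// integral_ge0.
have := Fubini iF; rewrite /= => /(congr1 fine).
rewrite [X in X = _ -> _](_ : _ = \int[mu]_(x in I) (g x * \int[mu]_(t in `[a, x]) k t));
  last first.
  rewrite Rintegral_mkcond /Rintegral; congr fine; apply: eq_integral => x _.
  rewrite patchE; case: ifPn => [xI|xI]; last first.
    rewrite integral0_eq// => t _; rewrite /F/= /G patchE (negbTE xI) mul0r.
    by case: ifP.
  transitivity (\int[mu]_t ((g x)%:E * (k \_ `[a, x] t)%:E))%E.
    apply: eq_integral => t _; rewrite /F/= /G/K !patchE xI.
    move: (xI); rewrite mem_itvcc => /andP[ax xb].
    rewrite !mem_itvcc; have [tx|xt] := leP t x.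
      by rewrite (le_trans tx xb) !andbT EFinM.
    by rewrite andbF mule0.
  have ikx : mu.-integrable setT (EFin \o k \_ `[a, x]).
    apply: integrable_patch => //; apply: integrableS ik => //.
    by move: (xI); rewrite mem_itvcc => /andP[_ xb]; exact: subset_itvl.
  rewrite integralZl//= EFinM; congr (_ * _)%E.
  rewrite -[fine _]/(\int[mu]_(t in `[a, x]) k t) Rintegral_mkcond.
  by rewrite fineK//; exact: integrable_fin_num.
move=> ->.
rewrite Rintegral_mkcond /Rintegral; congr fine; apply: eq_integral => x _.
rewrite patchE; case: ifPn => [xI|xI]; last first.
  rewrite integral0_eq// => t _; rewrite /F/= /K patchE (negbTE xI) mulr0.
  by case: ifP.
transitivity (\int[mu]_t ((k x)%:E * (g \_ `[x, b] t)%:E))%E.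
  apply: eq_integral => t _; rewrite /F/= /G/K !patchE xI.
  move: (xI); rewrite mem_itvcc => /andP[ax xb].
  rewrite !mem_itvcc; have [tx|xt] := leP x t.
    by rewrite (le_trans ax tx) /= mulrC EFinM.
  by rewrite /= mule0.
have ikx : mu.-integrable setT (EFin \o g \_ `[x, b]).
  apply: integrable_patch => //; apply: integrableS ig => //.
  by move: (xI); rewrite mem_itvcc => /andP[xb _]; exact: subset_itvr.
rewrite integralZl//= EFinM; congr (_ * _)%E.
rewrite -[fine _]/(\int[mu]_(t in `[x, b]) g t) Rintegral_mkcond.
by rewrite fineK//; exact: integrable_fin_num.
Qed.

(** Absolute continuity of h with density g, in integral form: g is merely integrable, so in general
    h has no derivative at every point. *)
Definition primitive a b h g := mu.-integrable `[a, b] (EFin \o g) /\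
  forall x, a <= x <= b -> h x = h a + \int[mu]_(t in `[a, x]) g t.

Lemma primitive_continuous a b h g : a <= b -> primitive a b h g ->
  {within `[a, b], continuous h}.
Proof.
move=> ab [ig hg].
have c := parameterized_integral_continuous ab ig.
apply: (@subspace_eq_continuous _ _ _ (fun x => h a + \int[mu]_(t in `[a, x]) g t)).
  by move=> x; rewrite mem_itvcc => /hg; rewrite /from_subspace => ->.
by move=> x; apply: cvgD; [exact: cvg_cst|exact: c].
Qed.

Lemma primitive_bounded a b h g : a <= b -> primitive a b h g ->
  exists M : R, forall x, a <= x <= b -> `|h x| <= M.
Proof.
move=> ab /(primitive_continuous ab) c.
have K := continuous_compact c (@segment_compact R a b).
have [M [Mr HM]] := compact_bounded K.
exists (`|M| + 1) => x xab; apply: (HM (`|M| + 1)).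
  by rewrite (le_lt_trans (ler_norm _))// ltrDl.
by exists x => //=; rewrite in_itv.
Qed.

Lemma primitive_mfun a b h g : a <= b -> primitive a b h g ->
  measurable_fun (`[a, b]%classic : set (measurableTypeR R)) h.
Proof.
move=> ab /(primitive_continuous ab) c.
by apply: subspace_continuous_measurable_fun => //; exact: measurable_itv.
Qed.

Lemma primitive_integrableM a b h g k : a <= b -> primitive a b h g ->
  mu.-integrable `[a, b] (EFin \o k) ->
  mu.-integrable `[a, b] (EFin \o (fun x => k x * h x)).
Proof.
move=> ab hg ik.
have [M HM] := primitive_bounded ab hg.
apply: (integrableMl _ ik (primitive_mfun ab hg)); first exact: measurable_itv.
by apply: (@bounded_on _ _ M) => x /=; rewrite in_itv/=; exact: HM.
Qed.

(** Inserting the integral formulas for h and w leaves one double integral over a triangle, whose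
    order [triangle_fubini] exchanges; the inner integral over [x, b] is then the total minus the
    one over [a, x]. *)
Lemma primitive_by_parts a b h g w k : a <= b ->
  primitive a b h g -> primitive a b w k ->
  \int[mu]_(x in `[a, b]) (g x * w x) =
  h b * w b - h a * w a - \int[mu]_(x in `[a, b]) (k x * h x).
Proof.
move=> ab hg wk.
have [ig Hg] := hg; have [ik Hk] := wk.
have iT := triangle_fubini ig ik.
have mI : measurable (`[a, b]%classic : set (measurableTypeR R)) by exact: measurable_itv.
have igW : mu.-integrable `[a, b] (EFin \o (fun x => g x * \int[mu]_(t in `[a, x]) k t)).
  apply: (@primitive_integrableM a b (fun x => \int[mu]_(t in `[a, x]) k t) k) => //.
  by split => // x _; rewrite set_itv1 Rintegral_set1 add0r.
have ikH : mu.-integrable `[a, b] (EFin \o (fun x => k x * \int[mu]_(t in `[a, x]) g t)).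
  apply: (@primitive_integrableM a b (fun x => \int[mu]_(t in `[a, x]) g t) g) => //.
  by split => // x _; rewrite set_itv1 Rintegral_set1 add0r.
have E1 : \int[mu]_(x in `[a, b]) (g x * w x) =
  \int[mu]_(x in `[a, b]) g x * w a
  + \int[mu]_(x in `[a, b]) (g x * \int[mu]_(t in `[a, x]) k t).
  rewrite -(RintegralZr _ mI ig).
  rewrite -(RintegralD mI (integrable_scaler _ mI ig) igW).
  by apply: eq_Rintegral => x; rewrite mem_itvcc => /Hk ->; rewrite mulrDr.
have E2 : \int[mu]_(x in `[a, b]) (k x * h x) =
  \int[mu]_(x in `[a, b]) k x * h a
  + \int[mu]_(x in `[a, b]) (k x * \int[mu]_(t in `[a, x]) g t).
  rewrite -(RintegralZr _ mI ik).
  rewrite -(RintegralD mI (integrable_scaler _ mI ik) ikH).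
  by apply: eq_Rintegral => x; rewrite mem_itvcc => /Hg ->; rewrite mulrDr.
have E3 : \int[mu]_(x in `[a, b]) (k x * \int[mu]_(t in `[x, b]) g t) =
  \int[mu]_(x in `[a, b]) k x * \int[mu]_(x in `[a, b]) g x
  - \int[mu]_(x in `[a, b]) (k x * \int[mu]_(t in `[a, x]) g t).
  rewrite -(RintegralZr _ mI ik).
  rewrite -(RintegralB mI (integrable_scaler _ mI ik) ikH).
  apply: eq_Rintegral => x; rewrite mem_itvcc => /andP[ax xb].
  rewrite -mulrBr Rintegral_itvB ?bnd_simp//.
  rewrite Rintegral_itv_obnd_cbnd//.
  by apply: integrableS ig => //; apply: subset_itvr; rewrite bnd_simp.
have hb := Hg b; rewrite ab lexx in hb; rewrite hb//.
have wb := Hk b; rewrite ab lexx in wb; rewrite wb//.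
rewrite E1 E2 iT E3; ring.
Qed.

Lemma primitive_C1 a b f : a < b -> (forall x, derivable f x 1) ->
  continuous (derive1 f) -> primitive a b f (derive1 f).
Proof.
move=> ab df cf.
have cc (c d : R) : {within `[c, d], continuous (derive1 f)}.
  exact: continuous_subspaceT.
split; first by exact: (continuous_compact_integrable (@segment_compact R a b) (cc a b)).
have ctsf x : {for x, continuous f}.
  by apply: differentiable_continuous; exact/derivable1_diffP.
move=> x /andP[]; rewrite le_eqVlt => /predU1P[<- _|ax xb].
  by rewrite set_itv1 Rintegral_set1 addr0.
have E : (\int[mu]_(t in `[a, x]) ((derive1 f) t)%:E = (f x)%:E - (f a)%:E)%E.
  apply: (continuous_FTC2 ax (cc a x)) => //.
  split => //.
  - by apply: cvg_at_right_filter; exact: ctsf.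
  - by apply: cvg_at_left_filter; exact: ctsf.
by rewrite /Rintegral E subrKC.
Qed.

End Primitives.

(** * Weak derivatives *)

Section WeakDerivative.
Context {R : realType}.
Notation mu := (@lebesgue_measure R).
Implicit Types (Om : set R) (a b c x y z : R) (f g h psi dpsi phi : R -> R).

Lemma near_natSinv (e : R) : 0 < e -> \forall n \near \oo, n.+1%:R^-1 < e.
Proof. by move=> e0; exact: (near_infty_natSinv_lt (PosNum e0)). Qed.

Lemma ae_mono (P Q : R -> Prop) : {ae mu, forall x, P x} ->
  (forall x, P x -> Q x) -> {ae mu, forall x, Q x}.
Proof. by move=> aeP PQ; apply: filterS aeP; first exact: (ae_filter_ringOfSetsType mu). Qed.

Lemma ae_conj (P Q : R -> Prop) : {ae mu, forall x, P x} ->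
  {ae mu, forall x, Q x} -> {ae mu, forall x, P x /\ Q x}.
Proof. by move=> aeP aeQ; apply: filterI; first exact: (ae_filter_ringOfSetsType mu). Qed.

Lemma eq_Rintegral_ae (D : set (measurableTypeR R)) f g : measurable D ->
  measurable_fun D f -> measurable_fun D g ->
  {ae mu, forall x, D x -> f x = g x} ->
  \int[mu]_(x in D) f x = \int[mu]_(x in D) g x.
Proof.
move=> mD mf mg fg; rewrite /Rintegral; congr fine.
apply: ae_eq_integral => //; [exact/measurable_EFinP..|].
by apply: (ae_mono fg) => x /= E Dx; rewrite E.
Qed.

Lemma dominated_Rintegral (D : set (measurableTypeR R)) (f_ : nat -> R -> R) f g :
  measurable D -> (forall n, measurable_fun D (f_ n)) ->
  (forall x, D x -> f_ n x @[n --> \oo] --> f x) ->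
  mu.-integrable D (EFin \o g) ->
  (forall n x, D x -> `|f_ n x| <= g x) ->
  \int[mu]_(x in D) f_ n x @[n --> \oo] --> \int[mu]_(x in D) f x.
Proof.
move=> mD mf ff ig fg.
have mg := integrable_mfun ig.
have mlim : measurable_fun D f.
  by apply: (measurable_fun_cvg mf) => x Dx; exact: ff.
have if_ : mu.-integrable D (EFin \o f).
  apply: (le_integrable mD _ _ ig); first exact/measurable_EFinP.
  move=> x Dx /=; rewrite lee_fin.
  have gx0 : 0 <= g x by apply: le_trans (fg 0%N x Dx).
  rewrite (ger0_norm gx0).
  have cn : `|f_ n x| @[n --> \oo] --> `|f x| by apply: cvg_norm; exact: ff.
  rewrite -(cvg_lim _ cn)//; apply: limr_le; first by apply/cvg_ex; exists `|f x|.
  by near=> n; exact: fg.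
have /fine_cvgP[_] : (\int[mu]_(x in D) (f_ n x)%:E @[n --> \oo] --> (\int[mu]_(x in D) f x)%:E)%E.
  rewrite /Rintegral fineK; last exact: integrable_fin_num.
  apply: (@dominated_cvg _ _ _ mu D mD (fun n => EFin \o f_ n) (EFin \o f) (EFin \o g)) => //.
  - by move=> n; exact/measurable_EFinP.
  - by move=> x Dx; apply: cvg_EFin; [near=> n|exact: ff].
by [].
Unshelve. all: by end_near. Qed.

(** The support of [rho n] shrinks like 1/(n+1) while its size grows like n+1, so its $L^1$ norm
    stays bounded and continuity of h at z suffices. The point z may be an end of the interval,
    which is how boundary values are recovered. *)
Lemma approximate_unit a b z h (rho : nat -> R -> R) (M C : R) : a < b ->
  a <= z <= b -> {within `[a, b], continuous h} ->
  (forall n, continuous (rho n)) ->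
  (\forall n \near \oo, \int[mu]_(t in `[a, b]) rho n t = 1) ->
  (forall n t, C * n.+1%:R^-1 < `|t - z| -> rho n t = 0) ->
  (forall n t, `|rho n t| <= M * n.+1%:R) ->
  \int[mu]_(t in `[a, b]) (h t * rho n t) @[n --> \oo] --> h z.
Proof.
move=> ab zab hc rc r1 r0 rM.
have M0 : 0 <= M.
  by have := le_trans (normr_ge0 _) (rM 0%N 0); rewrite mulr1.
have mI : measurable (`[a, b]%classic : set (measurableTypeR R)) by exact: measurable_itv.
have ir n : mu.-integrable `[a, b] (EFin \o rho n).
  exact: (continuous_compact_integrable (@segment_compact R a b) (continuous_subspaceT (rc n))).
have ih : mu.-integrable `[a, b] (EFin \o h).
  exact: (continuous_compact_integrable (@segment_compact R a b) hc).
have ihr n : mu.-integrable `[a, b] (EFin \o (fun t => h t * rho n t)).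
  apply: (integrableMl mI ih (integrable_mfun (ir n))).
  by apply: (@bounded_on _ _ _ (M * n.+1%:R)) => x _; exact: rM.
(* The product of the length of the support and the supremum bounds the $L^1$ norm of [rho n] by
   2M|C|; the added 1 keeps the denominator positive. *)
pose e1 e := e / (M * (2 * `|C|) + 1).
apply/cvgrPdist_le => /= e e0.
have K0 : 0 < M * (2 * `|C|) + 1 by rewrite ltr_wpDl// !mulr_ge0.
have e10 : 0 < e1 e by rewrite divr_gt0.
have /subspace_continuousP/(_ z) := hc.
rewrite /= in_itv/= => /(_ zab)/cvgrPdist_le /(_ _ e10).
move=> [d /= d0 hd].
have ndoo : \forall n \near \oo, `|C| * n.+1%:R^-1 < d.
  have [->|C0] := eqVneq C 0.
    by near=> n; rewrite normr0 mul0r.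
  have Cd : 0 < `|C|^-1 * d by rewrite mulr_gt0 ?invr_gt0 ?normr_gt0.
  near=> n; rewrite -ltr_pdivlMl ?normr_gt0//.
  by near: n; exact: near_natSinv.
near=> n.
have n1 : \int[mu]_(t in `[a, b]) rho n t = 1 by near: n.
have nd : `|C| * n.+1%:R^-1 < d by near: n.
have -> : h z - \int[mu]_(t in `[a, b]) (h t * rho n t) =
   \int[mu]_(t in `[a, b]) (rho n t * h z - h t * rho n t).
  rewrite RintegralB//; last exact: integrable_scaler.
  by rewrite RintegralZr// n1 mul1r.
set F := fun t => rho n t * h z - h t * rho n t.
have iF : mu.-integrable `[a, b] (EFin \o F).
  exact: (integrableB mI (integrable_scaler _ mI (ir n)) (ihr n)).
apply: (le_trans (le_normr_Rintegral mI iF)).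
pose J := `[z - `|C| * n.+1%:R^-1, z + `|C| * n.+1%:R^-1]%classic : set (measurableTypeR R).
have -> : \int[mu]_(t in `[a, b]) `|F t| = \int[mu]_(t in `[a, b] `&` J) `|F t|.
  rewrite Rintegral_mkcondr; apply: eq_Rintegral => t _.
  rewrite patchE; case: ifPn => //; rewrite mem_itvcc -ler_distlC => tJ.
  rewrite /F r0 ?mulr0 ?mul0r ?subr0 ?normr0//.
  rewrite ltNge; apply: contra tJ => /le_trans; rewrite distrC; apply.
  by rewrite ler_wpM2r ?invr_ge0// ler_norm.
have mJ : measurable J by exact: measurable_itv.
have mIJ : measurable (`[a, b] `&` J) by exact: measurableI.
apply: (@le_trans _ _ (\int[mu]_(t in `[a, b] `&` J) (cst (e1 e * (M * n.+1%:R)) t))).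
  apply: le_Rintegral => //.
  - have /integrable_abse H := iF.
    exact: (integrableS mI mIJ (@subIsetl _ _ _) H).
  - apply: (integrableS mI mIJ (@subIsetl _ _ _)).
    exact: (continuous_compact_integrable (@segment_compact R a b) (continuous_subspaceT (@cst_continuous _ _ _))).
  - move=> t [/= tab tJ]; rewrite /F mulrC -mulrBl normrM ler_pM//.
    apply: hd => //=.
    by move: tJ; rewrite /J/= in_itv/= -ler_distlC => /le_lt_trans; apply.
rewrite Rintegral_cst//.
have nn : 0 <= `|C| * n.+1%:R^-1 by rewrite mulr_ge0.
have J2 : fine (mu (`[a, b] `&` J)) <= 2 * (`|C| * n.+1%:R^-1).
  have mJE : mu J = (2 * (`|C| * n.+1%:R^-1))%:E.
    rewrite /J lebesgue_measure_itv/= lte_fin.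
    case: ltP => [_|]; first by rewrite -EFinD; congr EFin; ring.
    by move=> H; congr EFin; move: nn H; set w := _ / _; lra.
  rewrite -lee_fin -mJE fineK.
    by apply: le_measure; rewrite ?inE//; exact: subIsetr.
  rewrite ge0_fin_numE//; apply: (@le_lt_trans _ _ (mu J)).
    by apply: le_measure; rewrite ?inE//; exact: subIsetr.
  by rewrite mJE ltry.
apply: (@le_trans _ _ (e1 e * (M * n.+1%:R) * (2 * (`|C| * n.+1%:R^-1)))).
  by apply: ler_wpM2l => //; rewrite mulr_ge0 ?(ltW e10)// mulr_ge0.
have -> : e1 e * (M * n.+1%:R) * (2 * (`|C| * n.+1%:R^-1)) = e1 e * (M * (2 * `|C|)) * (n.+1%:R / n.+1%:R).
  by ring.
rewrite divff ?pnatr_eq0// mulr1 /e1 -mulrA ler_piMr//; first exact: ltW.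
by rewrite ler_pdivrMl// mulr1 lerDl.
Unshelve. all: by end_near. Qed.

(** The transition takes place between z - c/(n+1) and z + (1 - c)/(n+1), so the shift c decides on
    which side of z the layer lies. *)
Definition ramp z c (n : nat) t : R := step (n.+1%:R * (t - z) + c).

Lemma smooth_ramp z c n : smooth (ramp z c n).
Proof.
rewrite (_ : ramp z c n = fun t => step (n.+1%:R * t + (c - n.+1%:R * z))).
  by apply: smooth_affine; exact: smooth_step.
by apply/funext => t; rewrite /ramp; congr step; ring.
Qed.

Lemma derive1_ramp z c n t :
  derive1 (ramp z c n) t = derive1 step (n.+1%:R * (t - z) + c) * n.+1%:R.
Proof.
pose g (t : R) : R := n.+1%:R * (t - z) + c.
have dg : is_derive t 1 g n.+1%:R.
  have H1 : is_derive t 1 (fun t : R => t - z) 1.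
    have H := @is_deriveB _ _ _ (@id R) (cst z) t 1 1 0 (is_derive_id _ _) (is_derive_cst _ _ _).
    by rewrite subr0 in H.
  have H2 : is_derive t 1 (fun t : R => n.+1%:R * (t - z)) n.+1%:R.
    by have := is_deriveZ n.+1%:R H1; rewrite /GRing.scale/= mulr1.
  have H := @is_deriveD _ _ _ _ (cst c) t 1 _ 0 H2 (is_derive_cst _ _ _).
  by rewrite addr0 in H.
have ds : is_derive (g t) 1 step (derive1 step (g t)).
  rewrite derive1E; apply: derivableP; apply: smooth_derivable; exact: smooth_step.
have H := is_derive1_comp ds dg.
by rewrite derive1E; apply: derive_val.
Qed.

Lemma Rintegral_derive1_ramp a b z c n : a < b ->
  \int[mu]_(t in `[a, b]) derive1 (ramp z c n) t = ramp z c n b - ramp z c n a.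
Proof.
move=> ab.
have [_ H] := primitive_C1 ab (fun t => @smooth_derivable _ _ t (smooth_ramp z c n))
  (smooth_continuous (smooth_derive1 (smooth_ramp z c n))).
by have := H b; rewrite (ltW ab) lexx => ->//; rewrite addrC addKr.
Qed.

Lemma near_natM (e : R) C : 0 < e -> \forall n \near \oo, C <= n.+1%:R * e.
Proof.
move=> e0; have K0 : 0 < (`|C| + 1)^-1 * e by rewrite mulr_gt0// invr_gt0 ltr_wpDl.
near=> n.
have : n.+1%:R^-1 < (`|C| + 1)^-1 * e by near: n; exact: near_natSinv.
rewrite -ltr_pdivrMl ?invr_gt0 ?ltr_wpDl// invrK.
rewrite ltr_pdivrMr// => H; rewrite mulrC; apply/ltW; apply: le_lt_trans H.
by rewrite (le_trans (ler_norm _))// lerDl.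
Unshelve. all: by end_near. Qed.

Lemma cvg_integral_ramp a b z c h : a < b -> a <= z <= b ->
  {within `[a, b], continuous h} ->
  (\forall n \near \oo, ramp z c n b - ramp z c n a = 1) ->
  \int[mu]_(t in `[a, b]) (h t * derive1 (ramp z c n) t) @[n --> \oo] --> h z.
Proof.
move=> ab zab hc H.
have [M M0 HM] := @derive1_step_bounded R.
(* Beyond the distance (|c|+1)/(n+1) from z, the argument of [step] lies outside [0, 1], where the
   derivative vanishes. *)
apply: (approximate_unit (M := M) (C := `|c| + 1)) => //.
- by move=> n; apply/smooth_continuous/smooth_derive1; exact: smooth_ramp.
- by near=> n; rewrite Rintegral_derive1_ramp//; near: n.
- move=> n t; rewrite ltr_pdivrMr// => nt; rewrite derive1_ramp.
  suff -> : derive1 step (n.+1%:R * (t - z) + c) = 0 :> R by rewrite mul0r.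
  apply: derive1_step_out; move: nt; rewrite mulrC.
  case: (ger0P (t - z)) => tz nt; [right|left].
    by have := ler_norm (- c); rewrite normrN; lra.
  by have := ler_norm c; lra.
- by move=> n t; rewrite derive1_ramp normrM normr_nat ler_wpM2r.
Unshelve. all: by end_near. Qed.

(** The shifts -1 and 2 place the layers at distances between 1/(n+1) and 2/(n+1) from the ends,
    inside ]a, b[, which makes the support compact there. *)
Definition plateau a b n t : R := ramp a (-1) n t - ramp b 2 n t.

Lemma smooth_plateau a b n : smooth (plateau a b n).
Proof.
apply: smoothD; first exact: smooth_ramp.
rewrite (_ : (fun _ => _) = fun t => -1 * ramp b 2 n t).
  by apply: smoothM; [exact: smooth_cst|exact: smooth_ramp].
by apply/funext => t; rewrite mulN1r.
Qed.

Lemma ramp_eq0 z c n t : n.+1%:R * (t - z) + c <= 0 -> ramp z c n t = 0.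
Proof. exact: step_le0. Qed.

Lemma ramp_eq1 z c n t : 1 <= n.+1%:R * (t - z) + c -> ramp z c n t = 1.
Proof. exact: step_ge1. Qed.

(** The threshold 3 puts the layers in the right order: to the left of the stated interval both
    ramps are 0, to the right both are 1. *)
Lemma plateau_supp a b n t : 3 <= n.+1%:R * (b - a) ->
  plateau a b n t != 0 -> a + n.+1%:R^-1 <= t <= b - n.+1%:R^-1.
Proof.
move=> nab; apply: contraNT; rewrite negb_and -!ltNge => /orP[t1|t1].
- have {}t1 : n.+1%:R * (t - a) < 1.
    by rewrite -ltr_pdivlMl// mulr1 ltrBlDl.
  rewrite /plateau !ramp_eq0 ?subrr//; lra.
- have {}t1 : 1 < n.+1%:R * (t - b) + 2.
    have : - (1 : R) < n.+1%:R * (t - b) by rewrite -ltr_pdivrMl// mulrN1 ltrBrDl.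
    lra.
  rewrite /plateau !ramp_eq1 ?subrr//; lra.
Qed.

Lemma plateau_test Om a b n : `]a, b[ `<=` Om -> 3 <= n.+1%:R * (b - a) ->
  test_function Om (plateau a b n).
Proof.
move=> abO nab.
have cl : closure [set x | plateau a b n x != 0] `<=` `[a + n.+1%:R^-1, b - n.+1%:R^-1].
  rewrite (closure_id `[_, _]%classic).1; last exact: interval_closed.
  by apply: closureS => t /= /(plateau_supp nab); rewrite in_itv.
split.
- by move=> m x; apply/smooth_derivable/smooth_derive1n; exact: smooth_plateau.
- apply: (subclosed_compact (@closed_closure _ _) _ cl); exact: segment_compact.
- apply: (subset_trans cl); apply: subset_trans abO => t /=; rewrite !in_itv/= => /andP[ta tb].
  by rewrite (lt_le_trans _ ta) ?ltrDl//= (le_lt_trans tb)// ltrBlDr ltrDl.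
Qed.

Lemma derive1_plateau a b n t :
  derive1 (plateau a b n) t = derive1 (ramp a (-1) n) t - derive1 (ramp b 2 n) t.
Proof.
rewrite derive1E deriveB; [by rewrite -!derive1E|apply: smooth_derivable..];
  exact: smooth_ramp.
Qed.

Lemma plateau_le1 a b n t : `|plateau a b n t| <= 1.
Proof.
rewrite ler_norml /plateau /ramp; set u := step _; set v := step _.
have := step_ge0 (n.+1%:R * (t - a) + -1); have := step_le1 (n.+1%:R * (t - a) + -1).
have := step_ge0 (n.+1%:R * (t - b) + 2); have := step_le1 (n.+1%:R * (t - b) + 2).
by rewrite -/u -/v; lra.
Qed.

Lemma cvg_plateau a b t : a < t < b -> plateau a b n t @[n --> \oo] --> (1 : R).
Proof.
move=> /andP[at' tb]; apply: cvg_near_cst.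
have h1 : 0 < t - a by rewrite subr_gt0.
have h2 : 0 < b - t by rewrite subr_gt0.
near=> n.
have n1 : 2 <= n.+1%:R * (t - a) by near: n; exact: near_natM.
have n2 : 2 <= n.+1%:R * (b - t) by near: n; exact: near_natM.
rewrite /plateau ramp_eq1 ?ramp_eq0 ?subr0//; last lra.
by rewrite -opprB mulrN; lra.
Unshelve. all: by end_near. Qed.

Lemma patch_mfun (D : set (measurableTypeR R)) f : measurable D ->
  measurable_fun D f -> measurable_fun (setT : set (measurableTypeR R)) (f \_ D).
Proof. by move=> mD; exact: (measurable_restrictT f mD).1. Qed.

(* Testing with plateau functions that converge to the indicator of ]a, b[: their
   derivatives are approximate units at a and b, where h is continuous. *)
Lemma weak_derivative_increment (Om : set (measurableTypeR R)) a b h psi dpsi :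
  measurable Om -> a < b -> `]a, b[ `<=` Om ->
  measurable_fun Om psi -> mu.-integrable `[a, b] (EFin \o dpsi) ->
  {within `[a, b], continuous h} ->
  {ae mu, forall x, Om x -> psi x = h x} ->
  (forall phi, test_function Om phi ->
     pairing Om psi (derive1 phi) = - pairing Om dpsi phi) ->
  h b = h a + \int[mu]_(t in `[a, b]) dpsi t.
Proof.
move=> mO ab abO mpsi idpsi hc psih weak.
have mI : measurable (`[a, b]%classic : set (measurableTypeR R)) by exact: measurable_itv.
have ba : 0 < b - a by rewrite subr_gt0.
have n3 : \forall n \near \oo, 3 <= n.+1%:R * (b - a) by exact: near_natM.
have z0 n t : 3 <= n.+1%:R * (b - a) -> ~~ (a < t < b) -> plateau a b n t = 0.
  move=> nab tab; apply/eqP; apply: contraNT tab => /(plateau_supp nab)/andP[ta tb].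
  by rewrite (lt_le_trans _ ta) ?ltrDl//= (le_lt_trans tb)// ltrBlDr ltrDl.
have dz0 n t : 3 <= n.+1%:R * (b - a) -> ~~ (a < t < b) -> derive1 (plateau a b n) t = 0.
  move=> nab; rewrite negb_and -!leNgt derive1_plateau !derive1_ramp => tab.
  rewrite !derive1_step_out ?mul0r ?subrr//; case/orP: tab => H.
  - by left; rewrite -opprB mulrN; have : n.+1%:R * (t - a) <= 0;
    [rewrite pmulr_rle0 ?subr_le0//|]; lra.
  - by right; have : 0 <= n.+1%:R * (t - b); [rewrite mulr_ge0 ?subr_ge0//|]; lra.
  - by left; have : n.+1%:R * (t - a) <= 0; [rewrite pmulr_rle0 ?subr_le0//|]; lra.
  - by right; have : 0 <= n.+1%:R * (t - b); [rewrite mulr_ge0 ?subr_ge0//|]; lra.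
have cdp n : continuous (derive1 (plateau a b n)).
  by apply/smooth_continuous/smooth_derive1; exact: smooth_plateau.
have mdp n : measurable_fun (setT : set (measurableTypeR R)) (derive1 (plateau a b n)).
  exact: continuous_measurable_fun.
have mp n : measurable_fun (setT : set (measurableTypeR R)) (plateau a b n).
  by apply: continuous_measurable_fun; apply/smooth_continuous; exact: smooth_plateau.
have ih : mu.-integrable `[a, b] (EFin \o h).
  exact: (continuous_compact_integrable (@segment_compact R a b) hc).
have E1 : \forall n \near \oo, \int[mu]_(t in `[a, b]) (h t * derive1 (plateau a b n) t) =
    pairing Om psi (derive1 (plateau a b n)).
  near=> n.
  have nab : 3 <= n.+1%:R * (b - a) by near: n.
  rewrite /pairing /Vol1 Rintegral_mkcond [RHS]Rintegral_mkcond.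
  apply: eq_Rintegral_ae => //.
  - apply: patch_mfun => //; apply: measurable_funM; first exact: integrable_mfun.
    exact: measurable_funTS.
  - apply: patch_mfun => //; apply: measurable_funM => //.
    exact: measurable_funTS.
  - apply: (ae_mono psih) => x E _; rewrite !patchE mem_itvcc.
    have [xab|xab] := boolP (a < x < b).
      case/andP: (xab) => ax xb; rewrite !ltW//=.
      have Ox : Om x by apply: abO; rewrite /= in_itv.
      by rewrite mem_set// E.
    by rewrite dz0// !mulr0; case: ifP; case: ifP.
have E2 : \forall n \near \oo, \int[mu]_(t in `[a, b]) (dpsi t * plateau a b n t) =
    pairing Om dpsi (plateau a b n).
  near=> n.
  have nab : 3 <= n.+1%:R * (b - a) by near: n.
  rewrite /pairing /Vol1 Rintegral_mkcond [RHS]Rintegral_mkcond.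
  apply: eq_Rintegral => x _; rewrite !patchE mem_itvcc.
  have [xab|xab] := boolP (a < x < b).
    case/andP: (xab) => ax xb; rewrite !ltW//=.
    by rewrite mem_set//; apply: abO; rewrite /= in_itv.
  by rewrite z0// !mulr0; case: ifP; case: ifP.
have C1 : \int[mu]_(t in `[a, b]) (h t * derive1 (plateau a b n) t) @[n --> \oo] --> h a - h b.
  have iR z c n : mu.-integrable `[a, b] (EFin \o (fun t => h t * derive1 (ramp z c n) t)).
    have c0 : {within `[a, b], continuous (derive1 (ramp z c n))}.
      by apply/continuous_subspaceT/smooth_continuous/smooth_derive1; exact: smooth_ramp.
    apply: (continuous_compact_integrable (@segment_compact R a b)).
    by move=> x; apply: cvgM; [exact: hc|exact: c0].
  rewrite (_ : (fun n => _) = (fun n => \int[mu]_(t in `[a, b]) (h t * derive1 (ramp a (-1) n) t)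
      - \int[mu]_(t in `[a, b]) (h t * derive1 (ramp b 2 n) t))); last first.
    apply/funext => n; rewrite -RintegralB//.
    by apply: eq_Rintegral => t _; rewrite derive1_plateau mulrBr.
  apply: cvgB; apply: cvg_integral_ramp => //; rewrite ?lexx ?ltW//=.
  - near=> n; have nab : 3 <= n.+1%:R * (b - a) by near: n.
    rewrite ramp_eq1; last lra.
    by rewrite ramp_eq0 ?subr0// subrr mulr0; lra.
  - near=> n; have nab : 3 <= n.+1%:R * (b - a) by near: n.
    rewrite ramp_eq1; last by rewrite subrr mulr0; lra.
    rewrite ramp_eq0 ?subr0// -opprB mulrN; lra.
(* The plateaus tend to 1 only in the open interval, so the null set of the two ends is removed
   before dominated convergence is applied. *)
have C2 : \int[mu]_(t in `[a, b]) (dpsi t * plateau a b n t) @[n --> \oo] -->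
    \int[mu]_(t in `]a, b[) dpsi t.
  have sub : `]a, b[%classic `<=` `[a, b] by exact: subset_itv_oo_cc.
  have mJ : measurable (`]a, b[%classic : set (measurableTypeR R)) by exact: measurable_itv.
  rewrite (_ : (fun n => _) = (fun n => \int[mu]_(t in `]a, b[) (dpsi t * plateau a b n t)));
    last first.
    apply/funext => n.
    have i1 : mu.-integrable `[a, b] (EFin \o (fun t => dpsi t * plateau a b n t)).
      apply: (integrableMl mI idpsi); first exact: measurable_funTS.
      by apply: (@bounded_on _ _ _ 1) => x _; exact: plateau_le1.
    rewrite -Rintegral_itv_bndo_bndc; last first.
      by apply: integrableS i1 => //; exact: subset_itv_co_cc.
    rewrite -Rintegral_itv_obnd_cbnd//; exact: (integrableS mI mJ).
  have idJ : mu.-integrable `]a, b[ (EFin \o dpsi) by exact: (integrableS mI mJ).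
  apply: (@dominated_Rintegral _ _ _ (fun t => `|dpsi t|)) => //.
  - by move=> n; apply: measurable_funM; [exact: integrable_mfun|exact: measurable_funTS].
  - move=> x /=; rewrite in_itv/= => xab; rewrite -[X in _ --> X]mulr1.
    by apply: cvgM; [exact: cvg_cst|exact: cvg_plateau].
  - exact: (integrable_abse idJ).
  - by move=> n x _; rewrite normrM ler_piMr// plateau_le1.
have E3 : h a - h b = - \int[mu]_(t in `]a, b[) dpsi t.
  apply: (cvg_unique _ C1) => //.
  apply: cvg_trans (cvgN C2); apply: near_eq_cvg; near=> n.
  have nab : 3 <= n.+1%:R * (b - a) by near: n.
  have e1 : \int[mu]_(t in `[a, b]) (h t * derive1 (plateau a b n) t) =
    pairing Om psi (derive1 (plateau a b n)) by near: n.
  have e2 : \int[mu]_(t in `[a, b]) (dpsi t * plateau a b n t) =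
    pairing Om dpsi (plateau a b n) by near: n.
  by rewrite e1 weak; [rewrite -e2|exact: plateau_test].
rewrite -Rintegral_itv_bndo_bndc; last first.
  by apply: (integrableS mI _ _ idpsi) => //; exact: subset_itv_co_cc.
rewrite -Rintegral_itv_obnd_cbnd//; last first.
  by apply: (integrableS mI _ _ idpsi) => //; exact: subset_itv_oo_cc.
by move: E3; lra.
Unshelve. all: by end_near. Qed.

Lemma Lp_mfun (Om : set (measurableTypeR R)) (p : R) f : measurable Om ->
  Lp Vol1 Om p f -> measurable_fun Om f.
Proof.
move=> mO; rewrite /Lp inE => /andP[/[!inE]/= mf _].
by apply/(measurable_restrictT f mO).
Qed.

(** On a set of finite measure $|f| \le 1 + |f|^p$ has an integrable right-hand side. *)
Lemma Lp_integrable (Om : set (measurableTypeR R)) (p : R) f : measurable Om ->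
  (mu Om < +oo)%E -> 1 <= p -> Lp Vol1 Om p f -> mu.-integrable Om (EFin \o f).
Proof.
move=> mO Ofin p1 fLp; have mf := Lp_mfun mO fLp.
have /integrableP[_ ip] := Lfun_integrable p1 fLp.
have ifp : mu.-integrable Om (EFin \o (fun x => `|f x| `^ p)).
  apply/integrableP; split.
    apply/measurable_EFinP; apply: (measurableT_comp (measurable_powR p)).
    exact: measurableT_comp.
  apply: le_lt_trans ip; rewrite [leLHS]integral_mkcond -/mu.
  apply: ge0_le_integral => //.
  - by move=> x _; rewrite patchE; case: ifP.
  - apply/(measurable_restrictT _ mO); apply: measurableT_comp => //.
    apply/measurable_EFinP; apply: (measurableT_comp (measurable_powR p)).
    exact: measurableT_comp.
  - apply: measurableT_comp => //; apply/measurable_EFinP.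
    apply: (measurableT_comp (measurable_powR p)).
    by apply: measurableT_comp => //; exact: patch_mfun.
  - by move=> x _; rewrite !patchE; case: ifP => // _; exact: abse_ge0.
have i1 : mu.-integrable Om (EFin \o (cst 1 : R -> R)).
  apply/integrableP; split; first by apply/measurable_EFinP; exact: measurable_cst.
  by rewrite /= normr1 integral_cst// mul1e.
apply: (le_integrable mO _ _ (integrable_addR mO i1 ifp)); first exact/measurable_EFinP.
move=> x _ /=; rewrite lee_fin (ger0_norm (addr_ge0 _ (powR_ge0 _ _)))//.
have [f1|f1] := lerP `|f x| 1; first by rewrite (le_trans f1)// lerDl powR_ge0.
have : `|f x| `^ 1 <= `|f x| `^ p by apply: ler_powR => //; exact: ltW.
by rewrite powRr1// => H; rewrite (le_trans H)// lerDr.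
Qed.

Lemma bounded_Lp (Om : set (measurableTypeR R)) (p M : R) f : measurable Om ->
  (mu Om < +oo)%E -> 0 < p -> measurable_fun Om f ->
  (forall x, Om x -> `|f x| <= M) -> Lp Vol1 Om p f.
Proof.
move=> mO Ofin p0 mf fM; rewrite /Lp inE; apply/andP; split; rewrite inE/=.
  exact: patch_mfun.
rewrite /finite_norm unlock poweR_lty//.
apply: (@le_lt_trans _ _ (\int[mu]_(x in Om) (`|M| `^ p)%:E)%E); last first.
  by rewrite integral_cst// lte_mul_pinfty// lee_fin powR_ge0.
rewrite [leRHS]integral_mkcond; apply: ge0_le_integral => //.
- by move=> x _; exact: poweR_ge0.
- apply/measurable_EFinP; apply: (measurableT_comp (measurable_powR p)).
  by apply: measurableT_comp => //; exact: patch_mfun.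
- by apply/(measurable_restrictT _ mO); exact: measurable_cst.
- move=> x _; rewrite /= !patchE; case: ifPn => [xO|_]; last first.
    by rewrite normr0 powR0// gt_eqF.
  rewrite lee_fin; apply: ge0_ler_powR; rewrite ?nnegrE ?(ltW p0)//.
  by rewrite (le_trans _ (ler_norm M))//; apply: fM; rewrite inE in xO.
Qed.

Lemma integrable_oo_cc a b f :
  mu.-integrable `]a, b[ (EFin \o f) -> mu.-integrable `[a, b] (EFin \o f).
Proof.
move=> /integrableP[mf fJ]; apply/integrableP; split.
  exact: (emeasurable_fun_itv_cc mf).
by rewrite integral_itv_bndoo//; exact: measurableT_comp.
Qed.

Lemma Rintegral_oo_cc a b f : mu.-integrable `]a, b[ (EFin \o f) ->
  \int[mu]_(x in `]a, b[) f x = \int[mu]_(x in `[a, b]) f x.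
Proof.
by move=> /integrableP[mf _]; rewrite /Rintegral -(integral_itv_bndoo true false mf).
Qed.

(** The increment formula is applied on every [a, x]. Since h is continuous up to a and b, the
    formula reaches the boundary values that define the trace. *)
Lemma sobolev_primitive (Om : set (measurableTypeR R)) (p : R) a b h psi dpsi :
  measurable Om -> (mu Om < +oo)%E -> 1 <= p -> a < b -> `]a, b[ `<=` Om ->
  {within `[a, b], continuous h} ->
  {ae mu, forall x, Om x -> psi x = h x} ->
  sobolev_deriv Om p psi dpsi -> primitive a b h dpsi.
Proof.
move=> mO Ofin p1 ab abO hc psih [psiLp dpsiLp weak].
have idO := Lp_integrable mO Ofin p1 dpsiLp.
have mJ : measurable (`]a, b[%classic : set (measurableTypeR R)) by exact: measurable_itv.
have mI : measurable (`[a, b]%classic : set (measurableTypeR R)) by exact: measurable_itv.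
have iI : mu.-integrable `[a, b] (EFin \o dpsi).
  by apply: integrable_oo_cc; exact: (integrableS mO mJ abO idO).
split => // x /andP[ax xb].
move: ax; rewrite le_eqVlt => /predU1P[<-|ax].
  by rewrite set_itv1 Rintegral_set1 addr0.
apply: (weak_derivative_increment (Om := Om) (psi := psi)) => //.
- by apply: subset_trans abO; exact: subset_itvl.
- exact: Lp_mfun psiLp.
- by apply: integrableS iI => //; exact: subset_itvl.
- by apply: continuous_subspaceW hc; exact: subset_itvl.
Qed.

End WeakDerivative.

(** * Components of a bounded Lipschitz set *)

Section Components.
Context {R : realType}.
Implicit Types (Om : set R) (a b x y z M : R).

(** The end is the supremum of the points outside [Om] below y. Openness prevents this supremum from
    lying in [Om], and hence from being y. *)
Lemma open_left_end Om y M : open Om -> (forall x, Om x -> `|x| <= M) -> Om y ->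
  exists a, [/\ a < y, ~ Om a & forall z, a < z <= y -> Om z].
Proof.
move=> oO bO Oy; pose S := [set z | z <= y /\ ~ Om z].
have S0 : S !=set0.
  exists (- `|M| - 1); split.
    have := bO _ Oy; rewrite ler_norml => /andP[+ _].
    by have := ler_norm M; lra.
  move=> /bO; rewrite ler0_norm; last by have := normr_ge0 M; lra.
  by have := ler_norm M; lra.
have Sub : has_ubound S by exists y => z [].
have nOa : ~ Om (sup S).
  move=> Oa; have /nbhs_ballP[e /= e0 eO] : nbhs (sup S) Om by exact: open_nbhs_nbhs.
  have [z [zy nz] ez] := sup_adherent e0 (conj S0 Sub).
  have zs : z <= sup S by apply: ub_le_sup => //; split.
  apply: nz; apply: eO; rewrite /ball/=.
  by rewrite ger0_norm ?subr_ge0//; lra.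
exists (sup S); split => //.
  have : sup S <= y by apply: ge_sup => // z [].
  by rewrite le_eqVlt => /predU1P[Sy|//]; exfalso; apply: nOa; rewrite Sy.
move=> z /andP[Sz zy]; apply: contrapT => nOz.
by have : z <= sup S; [apply: ub_le_sup => //; split|rewrite leNgt Sz].
Qed.

Lemma open_right_end Om y M : open Om -> (forall x, Om x -> `|x| <= M) -> Om y ->
  exists b, [/\ y < b, ~ Om b & forall z, y <= z < b -> Om z].
Proof.
move=> oO bO Oy.
have oO' : open [set x | Om (- x)].
  have c : continuous (fun x : R => - x) by move=> x; exact: opp_continuous.
  by move/continuousP: c => /(_ _ oO).
have [||a [ay na aO]] := @open_left_end _ (- y) M oO'.
- by move=> x /bO; rewrite normrN.
- by rewrite /= opprK.
exists (- a); split => //; first by rewrite ltrNr.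
move=> z /andP[yz za]; rewrite -[z]opprK; apply: aO.
by rewrite ltrNr za/= lerN2.
Qed.

Definition component Om a b :=
  [/\ a < b, ~ Om a, ~ Om b & forall z, a < z < b -> Om z].

Lemma component_at Om y M : open Om -> (forall x, Om x -> `|x| <= M) -> Om y ->
  exists a b, component Om a b /\ a < y < b.
Proof.
move=> oO bO Oy.
have [a [ay na aO]] := open_left_end oO bO Oy.
have [b [yb nb Ob]] := open_right_end oO bO Oy.
exists a, b; split; last by rewrite ay yb.
split=> // [|z /andP[az zb]]; first exact: lt_trans yb.
have [zy|/ltW yz] := leP z y; first by apply: aO; rewrite az.
by apply: Ob; rewrite yz.
Qed.

Lemma component_disjoint Om a b a' b' : component Om a b -> component Om a' b' ->
  a < a' -> b <= a'.
Proof.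
move=> [ab _ _ abO] [_ na' _ _] aa'; rewrite leNgt; apply/negP => a'b.
by apply: na'; apply: abO; rewrite aa'.
Qed.

Lemma component_right_uniq Om a b b' : component Om a b -> component Om a b' -> b = b'.
Proof.
move=> [ab _ nb abO] [ab' _ nb' ab'O]; apply/eqP; rewrite eq_le !leNgt.
by apply/andP; split; apply/negP => bb'; [apply: nb'; apply: abO|apply: nb; apply: ab'O];
  rewrite ?ab ?ab'.
Qed.

Lemma open_boundary Om x : open Om -> boundary Om x <-> closure Om x /\ ~ Om x.
Proof. by move=> /interior_id E; rewrite /boundary E. Qed.

Lemma component_boundary Om a b : open Om -> component Om a b ->
  boundary Om a /\ boundary Om b.
Proof.
move=> oO [ab na nb abO]; rewrite !open_boundary//; split; split => //.
- move=> B /nbhs_ballP[e /= e0 eB].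
  pose d := Num.min (e / 2) ((b - a) / 2).
  have d0 : 0 < d by rewrite lt_min !divr_gt0 ?subr_gt0.
  have d1 : d <= e / 2 by rewrite ge_min lexx.
  have d2 : d <= (b - a) / 2 by rewrite ge_min lexx orbT.
  exists (a + d); split; first by apply: abO; rewrite ltrDl d0/=; lra.
  by apply: eB; rewrite /ball/= opprD addNKr normrN gtr0_norm//; lra.
- move=> B /nbhs_ballP[e /= e0 eB].
  pose d := Num.min (e / 2) ((b - a) / 2).
  have d0 : 0 < d by rewrite lt_min !divr_gt0 ?subr_gt0.
  have d1 : d <= e / 2 by rewrite ge_min lexx.
  have d2 : d <= (b - a) / 2 by rewrite ge_min lexx orbT.
  exists (b - d); split; first by apply: abO; apply/andP; split; lra.
  by apply: eB; rewrite /ball/= opprB addrCA subrr addr0 gtr0_norm//; lra.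
Qed.

(** On the side of x filled by [Om], the point at distance e/2 lies in some component. That
    component cannot stop before x, where [Om] is full, nor extend past x, which is outside [Om]. *)
Lemma boundary_component Om x M : open Om -> (forall x, Om x -> `|x| <= M) ->
  lipschitz_boundary Om -> boundary Om x ->
  (exists b, component Om x b) \/ (exists a, component Om a x).
Proof.
move=> oO bO lO bx; have [e e0 [H|H]] := lO x bx; have [_ nx] := (open_boundary _ oO).1 bx.
- left; have xe : Om (x + e / 2).
    apply/H; last by rewrite ltrDl divr_gt0.
    by rewrite /ball/= opprD addNKr normrN gtr0_norm ?divr_gt0//; lra.
  have [a [b [[ab na nb abO] /andP[ay yb]]]] := component_at oO bO xe.
  exists b; suff <- : a = x by [].
  apply/eqP; rewrite eq_le !leNgt; apply/andP; split; apply/negP => ax.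
    apply: na; apply/H => //; rewrite /ball/= ltr0_norm ?subr_lt0//; lra.
  by apply: nx; apply: abO; rewrite ax/=; lra.
- right; have xe : Om (x - e / 2).
    apply/H; last by rewrite ltrBlDr ltrDl divr_gt0.
    by rewrite /ball/= opprB addrCA subrr addr0 gtr0_norm ?divr_gt0//; lra.
  have [a [b [[ab na nb abO] /andP[ay yb]]]] := component_at oO bO xe.
  exists a; suff <- : b = x by [].
  apply/eqP; rewrite eq_le !leNgt; apply/andP; split; apply/negP => bx'.
    by apply: nx; apply: abO; rewrite bx' andbT; lra.
  by apply: nb; apply/H => //; rewrite /ball/= gtr0_norm ?subr_gt0//; lra.
Qed.

(** The boundary is compact, and the graph condition isolates each of its points, so a finite
    subcover by isolating balls lists them all. *)
Lemma boundary_finite Om M : open Om -> (forall x, Om x -> `|x| <= M) ->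
  lipschitz_boundary Om -> finite_set (boundary Om).
Proof.
move=> oO bO lO.
have cl : closed (boundary Om).
  have -> : boundary Om = closure Om `&` ~` Om.
    by apply/seteqP; split=> x; rewrite open_boundary.
  by apply: closedI; [exact: closed_closure|exact: open_closedC].
have K : compact (boundary Om).
  apply: (@subclosed_compact _ _ `[- M, M]) => //; first exact: segment_compact.
  have sub : closure Om `<=` `[- M, M].
    rewrite (closure_id `[_, _]%classic).1; last exact: interval_closed.
    by apply: closureS => x /bO /=; rewrite in_itv/= ler_norml.
  by move=> x /(open_boundary _ oO).1[/sub].
have isol x : boundary Om x -> {e : R | 0 < e & forall y, ball x e y -> boundary Om y -> y = x}.
  move=> bx; apply: cid2; have [e e0 H] := lO x bx; exists e => // y bey by_.
  have [cy ny] := (open_boundary _ oO).1 by_.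
  apply: contrapT => /eqP yx.
  (* On the filled side y itself lies in [Om], and any neighbourhood serves; on the empty side half
     of the ball misses [Om]. Either way y cannot be a closure point outside [Om]. *)
  have [xy nOm] : exists B : set R, nbhs y B /\ forall z, B z -> Om z -> Om y.
    case: H => H; move: yx; rewrite neq_lt => /orP[yx|xy].
    - exists (ball x e `&` [set z | z < x]); split.
        by apply: filterI; [apply: open_nbhs_nbhs; split => //;
          exact: ball_open|exact: lt_nbhsl].
      by move=> z [ez zx] /H; move/(_ ez) => xz; exfalso; move: (lt_trans xz zx); rewrite ltxx.
    - by exists setT; split; [exact: filterT|move=> z _ _; apply/H].
    - by exists setT; split; [exact: filterT|move=> z _ _; apply/H].
    - exists (ball x e `&` [set z | x < z]); split.
        by apply: filterI; [apply: open_nbhs_nbhs; split => //;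
          exact: ball_open|exact: lt_nbhsr].
      by move=> z [ez zx] /H; move/(_ ez) => xz; exfalso; move: (lt_trans xz zx); rewrite ltxx.
  by case: nOm => By HB; have [z [Oz Bz]] := cy _ By; exact/ny/(HB z).
pose U x := if pselect (boundary Om x) is left bx then ball x (s2val (isol x bx)) else set0.
move: K; rewrite compact_cover => /(_ _ (boundary Om) U).
case.
- move=> x bx; rewrite /U; case: pselect => // bx'; by apply: ball_open;
  exact: (s2valP (isol x bx')).
- move=> x bx; exists x => //; rewrite /U; case: pselect => // bx'.
  by apply: ballxx; exact: (s2valP (isol x bx')).
- move=> D' D'b cov; apply: sub_finite_set (finite_fset D').
  move=> x bx; have [y /= yD] := cov x bx.
  rewrite /U; case: pselect => // by_ /(s2valP' (isol y by_)) -> //.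
Qed.

(** Components are indexed by their left ends. The strict inequality in [comp_sep] makes closures
    disjoint, excluding sets such as ]0, 1[ united with ]1, 2[, so a boundary point has a single
    component and a single side. *)
Record components Om (s : seq R) (e : R -> R) : Prop := Components {
  comp_uniq : uniq s;
  comp_lt : forall a, a \in s -> a < e a;
  comp_sep : forall a a', a \in s -> a' \in s -> a < a' -> e a < a';
  comp_mem : forall x, Om x <-> exists2 a, a \in s & a < x < e a;
  comp_boundary : forall x, boundary Om x <-> exists2 a, a \in s & x = a \/ x = e a
}.

Lemma lipschitz_components Om : open Om -> bounded_set Om -> lipschitz_boundary Om ->
  exists s e, components Om s e.
Proof.
move=> oO [M0 [_ bO]] lO; pose M : R := `|M0| + 1.
have {}bO : forall x, Om x -> `|x| <= M.
  by move=> x Ox; apply: (bO M _ x Ox); rewrite /M (le_lt_trans (ler_norm _))// ltrDl.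
have fL : finite_set [set a | exists b, component Om a b].
  apply: sub_finite_set (boundary_finite oO bO lO) => a [b ab].
  by have [] := component_boundary oO ab.
have [s0 s0E] := (finite_seqP _).1 fL.
pose e a : R := xget 0 [set b | component Om a b].
have sP a : a \in undup s0 -> component Om a (e a).
  rewrite mem_undup => as0; have : [set` s0] a by [].
  by rewrite -s0E => -[b ab]; apply: (@xgetPex _ _ [set b | component Om a b]); exists b.
have Ps a b : component Om a b -> a \in undup s0 /\ b = e a.
  move=> ab; have as0 : a \in undup s0.
    rewrite mem_undup; suff : [set` s0] a by [].
    by rewrite -s0E; exists b.
  by split => //; exact: component_right_uniq ab (sP _ as0).
exists (undup s0), e; split.
- exact: undup_uniq.
- by move=> a /sP[].
(* Two components with a common end would put points of [Om] on both sides of it, against the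
   one-sided graph condition. *)
- move=> a a' /sP ca /sP ca' aa'.
  rewrite lt_neqAle (component_disjoint ca ca' aa') andbT; apply/eqP => E.
  have [_ bea] := component_boundary oO ca.
  have [d d0 H] := lO _ bea.
  case: ca ca' => [ab _ _ abO] [ab' _ _ ab'O].
  set b : R := e a in E H ab abO bea *; rewrite -E in ab' ab'O.
  pose h1 := Num.min (d / 2) ((b - a) / 2).
  have p1 : 0 < h1 by rewrite lt_min !divr_gt0 ?subr_gt0.
  have p2 : h1 <= d / 2 by rewrite ge_min lexx.
  have p3 : h1 <= (b - a) / 2 by rewrite ge_min lexx orbT.
  pose h2 := Num.min (d / 2) ((e b - b) / 2).
  have q1 : 0 < h2 by rewrite lt_min !divr_gt0 ?subr_gt0.
  have q2 : h2 <= d / 2 by rewrite ge_min lexx.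
  have q3 : h2 <= (e b - b) / 2 by rewrite ge_min lexx orbT.
  case: H => H.
    have : Om (b - h1) by apply: abO; apply/andP; split; lra.
    by move/H => H1; have := H1 _; rewrite /ball/= opprB addrCA subrr addr0 gtr0_norm//; lra.
  have : Om (b + h2) by apply: ab'O; apply/andP; split; lra.
  by move/H => H1; have := H1 _; rewrite /ball/= opprD addNKr normrN gtr0_norm//; lra.
- move=> x; split => [Ox|[a /sP[_ _ _ abO] axb]]; last exact: abO.
  have [a [b [cab axb]]] := component_at oO bO Ox.
  by have [as_ bE] := Ps _ _ cab; exists a => //; rewrite -bE.
- move=> x; split => [bx|[a /sP ca [->|->]]]; last 2 first.
  + by have [] := component_boundary oO ca.
  + by have [] := component_boundary oO ca.
  have [[b xb]|[a ax]] := boundary_component oO bO lO bx.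
    by have [xs _] := Ps _ _ xb; exists x => //; left.
  by have [as_ xe] := Ps _ _ ax; exists a => //; right.
Qed.

End Components.

(** * The drag operator *)

Section Clarke.
Context {R : realType}.
Implicit Types (Psi : R -> R) (a v xi : R).

(* The upper limit defining the directional derivative runs over base points
   near [a], so it is an upper semicontinuous function of [a]. *)
Lemma clarke_subdiff_closed Psi (a_ xi_ : nat -> R) a xi :
  a_ n @[n --> \oo] --> a -> xi_ n @[n --> \oo] --> xi ->
  (\forall n \near \oo, clarke_subdiff Psi (a_ n) (xi_ n)) ->
  clarke_subdiff Psi a xi.
Proof.
move=> ca cxi Hn v; rewrite /clarke_deriv /limf_esup.
apply: le_ereal_inf_tmp => _ [V FV <-].
set f := fun yt : R * R => _ in FV *.
set S := ereal_sup _.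
have [W [W1 W2] WV] : exists2 W : set R * set R, nbhs a W.1 /\ nbhs (0 : R) W.2 &
    forall y t, W.1 y -> W.2 t -> [/\ 0 <= y, 0 < t & 0 <= y + t * v] -> V (y, t).
  by case: FV => W HW WV; exists W => // y t Wy Wt H; exact: (WV (y, t)).
move: W1; rewrite nbhsE => -[U [oU Ua] UW].
have FU : \forall n \near \oo, U (a_ n) by apply: ca; exact: open_nbhs_nbhs.
(* Since U is open and eventually contains [a_ n], the set V is also admissible in the upper limit
   at [a_ n], and the same supremum S bounds that limit. *)
have key : \forall n \near \oo, ((xi_ n * v)%:E <= S)%E.
  near=> n.
  have Un : U (a_ n) by near: n.
  have Cn : clarke_subdiff Psi (a_ n) (xi_ n) by near: n.
  apply: (le_trans (Cn v)); rewrite /clarke_deriv /limf_esup.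
  apply: ge_ereal_inf; exists S => //; exists V => //.
  exists (U, W.2); first by split => //; exact: open_nbhs_nbhs.
  by move=> [y t] [/= Uy Wt] H; apply: WV => //; exact: UW.
have cE : ((xi_ n * v)%:E @[n --> \oo] --> (xi * v)%:E)%E.
  by apply: cvg_EFin; [near=> n|apply: cvgM => //; exact: cvg_cst].
rewrite -(cvg_lim _ cE)//; apply: lime_le => //.
by apply/cvg_ex; exists (xi * v)%:E.
Unshelve. all: by end_near. Qed.

Lemma clarke_subdiff_convex Psi a xi xi' (t : R) : 0 <= t <= 1 ->
  clarke_subdiff Psi a xi -> clarke_subdiff Psi a xi' ->
  clarke_subdiff Psi a (t * xi + (1 - t) * xi').
Proof.
move=> /andP[t0 t1] H H' v.
have := H v; have := H' v; case: (clarke_deriv Psi a v) => [d| |]; [|by move=> _ _;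
  rewrite leey|by rewrite leeNy_eq].
rewrite !lee_fin => h' h.
have : t * (xi * v) <= t * d by rewrite ler_wpM2l.
have : (1 - t) * (xi' * v) <= (1 - t) * d by rewrite ler_wpM2l// subr_ge0.
lra.
Qed.

End Clarke.

(** * Lower limits of bounded sequences *)

Section LimInf.
Context {R : realType}.
Implicit Types (v : nat -> R) (B : R).

Lemma bounded_seq_has_lbound v B : (forall n, `|v n| <= B) -> has_lbound (range v).
Proof. by move=> vB; exists (- B) => _ [n _ <-]; have := vB n;
  rewrite ler_norml => /andP[]. Qed.

Lemma bounded_seq_has_ubound v B : (forall n, `|v n| <= B) -> has_ubound (range v).
Proof. by move=> vB; exists B => _ [n _ <-]; have := vB n; rewrite ler_norml => /andP[]. Qed.

(** This particular cluster value is used because, built from countable infima and a monotone limit,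
    it depends measurably on a parameter. *)
Definition lower_limit v : R := sup (range (infs v)).

Lemma cvg_infs_lower_limit v B : (forall n, `|v n| <= B) ->
  infs v n @[n --> \oo] --> lower_limit v.
Proof.
move=> vB; apply: cvg_infs_sup.
  exact: bounded_seq_has_ubound vB.
exact: bounded_seq_has_lbound vB.
Qed.

Lemma infs_le v B n k : (forall n, `|v n| <= B) -> (n <= k)%N -> infs v n <= v k.
Proof.
move=> vB nk; apply: ge_inf; last by exists k.
by exists (- B) => _ [j _ <-]; have := vB j; rewrite ler_norml => /andP[].
Qed.

Lemma infs_norm_le v B n : (forall n, `|v n| <= B) -> `|infs v n| <= B.
Proof.
move=> vB; rewrite ler_norml; apply/andP; split; last first.
  apply: (le_trans (infs_le vB (leqnn n))).
  by have := vB n; rewrite ler_norml => /andP[].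
apply: lb_le_inf; first by exists (v n); exists n => /=.
by move=> _ [j _ <-]; have := vB j; rewrite ler_norml => /andP[].
Qed.

(** A late tail infimum is close to the lower limit, and some term of that tail is close to the
    infimum. The condition k <= sigma k, weaker than monotonicity, already carries limits over to
    the subsequence. *)
Lemma lower_limit_subseq v B : (forall n, `|v n| <= B) ->
  exists sigma : nat -> nat, (forall k, (k <= sigma k)%N) /\
    v (sigma k) @[k --> \oo] --> lower_limit v.
Proof.
move=> vB.
have H k : exists m, (k <= m)%N /\ `|lower_limit v - v m| < k.+1%:R^-1.
  have k0 : 0 < (k.+1%:R : R)^-1 by rewrite invr_gt0.
  have /cvgrPdist_lt/(_ _ k0)[N _ HN] := cvg_infs_lower_limit vB.
  pose j := maxn k N.
  have := HN j (leq_maxr k N); rewrite /= ltr_norml => /andP[l1 l2].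
  have hi : has_inf (sdrop v j).
    split; first by exists (v j); exists j => /=.
    by exists (- B) => _ [i _ <-]; have := vB i; rewrite ler_norml => /andP[].
  have [|_ [m jm <-] mlt] := inf_adherent (eps := lower_limit v + k.+1%:R^-1 - infs v j) _ hi.
    by rewrite addrAC -ltrBlDr sub0r.
  have m1 : infs v j <= v m by exact: infs_le vB jm.
  exists m; split; first exact: leq_trans (leq_maxl k N) jm.
  rewrite -/(infs v j) addrC subrK in mlt.
  rewrite distrC ltr_norml ltrBlDl mlt andbT ltrBrDr.
  by apply: lt_le_trans m1; rewrite addrC -ltrBrDr opprK -ltrBlDl.
exists (fun k => projT1 (cid (H k))); split.
  by move=> k; case: cid => m [].
apply/cvgrPdist_lt => e e0; near=> k; case: cid => m /= [_ /lt_trans]; apply.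
near: k; exact: near_natSinv.
Unshelve. all: by end_near. Qed.

Lemma cvg_subseq (sigma : nat -> nat) v (l : R) : (forall k, (k <= sigma k)%N) ->
  v n @[n --> \oo] --> l -> v (sigma k) @[k --> \oo] --> l.
Proof.
move=> s_ge vl; apply: (cvg_comp sigma v _ vl).
move=> A [N _ NA]; exists N => // k /= Nk; apply: NA => /=; exact: leq_trans (s_ge k).
Qed.

End LimInf.

(** * Bounded measurable selections of the drag operator *)

Section DragSelections.
Context {R : realType}.
Notation mu := (@lebesgue_measure R).
Variables (Om : set (measurableTypeR R)) (r s : R) (D : R -> R)
  (Phi : R -> set R) (Psi : R -> R).
Hypotheses (mOm : measurable Om) (Om_fin : (mu Om < +oo)%E)
  (r_ge2 : 2 <= r) (drag_op : dissipative_drag Om r s D Phi Psi).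
Implicit Types (u lam Q : R -> R) (c m B K y : R) (I : set (measurableTypeR R)).

Definition drag_at u x (y : R) :=
  exists2 phi, Phi (D x * u x ^+ 2) phi & y = phi * (D x * u x).

(** Bounds replace $L^s$ integrability: on a component the velocity is a primitive, hence bounded,
    and pointwise bounds serve both lower limits and dominated convergence. *)
Definition selection I u lam :=
  [/\ measurable_fun I lam, exists B, forall x, I x -> `|lam x| <= B &
   {ae mu, forall x, I x -> drag_at u x (lam x)}].

Let growth_exp_ge0 : 0 <= (r - 2) / 2. Proof. by rewrite divr_ge0 ?subr_ge0. Qed.

Lemma sqr_le_norm (x K : R) : `|x| <= K -> x ^+ 2 <= K ^+ 2.
Proof.
move=> xK; rewrite -(real_normK (num_real x)) lerXn2r ?nnegrE//.
exact: le_trans xK.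
Qed.

Lemma drag_coef_bounds : exists d d' : R, [/\ 0 < d, d <= d' &
  forall x, Om x -> d <= D x <= d'].
Proof.
have [[x0 Ox0]|O0] := pselect (exists x, Om x); last first.
  by exists 1, 1; split => // x Ox; exfalso; apply: O0; exists x.
have := drag_coef_sup drag_op; have := drag_coef_inf drag_op.
set i := ereal_inf _; set S := ereal_sup _ => i0 Soo.
have iD x : Om x -> (i <= (D x)%:E)%E by move=> Ox; apply: ereal_inf_lbound; exists x.
have DS x : Om x -> ((D x)%:E <= S)%E by move=> Ox; apply: ereal_sup_ubound; exists x.
have fi : i \is a fin_num.
  by rewrite ge0_fin_numE ?ltW// (le_lt_trans (iD _ Ox0))// ltry.
have fS : S \is a fin_num.
  rewrite ge0_fin_numE//; apply: le_trans (DS _ Ox0).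
  by rewrite lee_fin ltW// (drag_coef_gt0 drag_op).
exists (fine i), (fine S); split.
- by rewrite -lte_fin fineK.
- by rewrite -lee_fin !fineK//; exact: le_trans (iD _ Ox0) (DS _ Ox0).
- by move=> x Ox; rewrite -!lee_fin !fineK// iD//= DS.
Qed.

Lemma drag_at_bounded K : exists B, forall u x y, Om x -> `|u x| <= K ->
  drag_at u x y -> `|y| <= B.
Proof.
have [d [d' [d0 dd' Dd]]] := drag_coef_bounds.
have [c [C [c0 C0 H]]] := drag_map_growth drag_op.
exists (C * (1 + (d' * K ^+ 2) `^ ((r - 2) / 2)) * (d' * K)).
move=> u x y Ox uK [phi Pphi ->].
have /andP[dD Dd'] := Dd x Ox.
have D0 : 0 <= D x by rewrite (le_trans _ dD)// ltW.
have K0 : 0 <= K by exact: le_trans uK.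
have d'0 : 0 <= d' by exact: le_trans Dd'.
have a0 : 0 <= D x * u x ^+ 2 by rewrite mulr_ge0// sqr_ge0.
have phi0 := drag_map_ge0 drag_op a0 Pphi.
have /andP[_ pC] := H _ _ a0 Pphi.
rewrite normrM ger0_norm//; apply: ler_pM => //.
  apply: (le_trans pC); rewrite ler_pM2l// lerD2l ge0_ler_powR// ?nnegrE//.
    by rewrite mulr_ge0// sqr_ge0.
  by apply: ler_pM => //; rewrite ?sqr_ge0// sqr_le_norm.
by rewrite normrM ger0_norm//; apply: ler_pM.
Qed.

(** Truncation at B changes lam only on the null set where the drag relation fails. The bound B
    depends on K but not on u, so it is uniform along a sequence of velocities. *)
Lemma clamp_selection I K : I `<=` Om -> measurable I ->
  exists2 B : R, 0 <= B & forall u lam, (forall x, I x -> `|u x| <= K) ->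
   measurable_fun I lam ->
   {ae mu, forall x, I x -> drag_at u x (lam x)} ->
  exists lam', [/\ measurable_fun I lam', forall x, I x -> `|lam' x| <= B,
   {ae mu, forall x, I x -> drag_at u x (lam' x)} &
   {ae mu, forall x, I x -> lam x = lam' x}].
Proof.
move=> IO mI; have [B HB] := drag_at_bounded K.
exists `|B| => // u lam uK ml al.
exists (fun x => Num.max (- `|B|) (Num.min (lam x) `|B|)).
have E : {ae mu, forall x, I x -> lam x = Num.max (- `|B|) (Num.min (lam x) `|B|)}.
  apply: (ae_mono al) => x H Ix.
  have lB : `|lam x| <= `|B|.
    by rewrite (le_trans _ (ler_norm B))// (HB u x)//; [exact: IO|exact: uK|exact: H].
  move: lB; rewrite ler_norml => /andP[l1 l2].
  by rewrite (min_idPl _)// (max_idPr _).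
split => //.
- apply: measurable_maxr; first exact: measurable_cst.
  by apply: measurable_minr => //; exact: measurable_cst.
- move=> x _; rewrite ler_norml le_max lexx/= ge_max ge_min lexx orbT andbT.
  by rewrite (le_trans _ (normr_ge0 B))// oppr_le0.
- by apply: (ae_mono (ae_conj al E)) => x [H1 H2] Ix; rewrite -H2//; exact: H1.
Qed.

Lemma selection_exists I u K : I `<=` Om -> measurable I -> measurable_fun I u ->
  (forall x, I x -> `|u x| <= K) -> exists lam, selection I u lam.
Proof.
move=> IO mI mu_ uK.
(* Nonemptiness is assumed for functions on all of [Om], so u is extended by 0; this assumption is
   the source of a measurable lam. *)
have uLp : Lp Vol1 Om r (u \_ I).
  apply: (@bounded_Lp _ _ _ `|K|) => //.
  - by apply: lt_le_trans r_ge2.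
  - by apply: measurable_funTS; exact: patch_mfun.
  - move=> x _; rewrite patchE; case: ifPn => [xI|_]; last by rewrite normr0.
    by rewrite (le_trans _ (ler_norm K))// uK//; rewrite inE in xI.
have [lam [lamLp al]] := drag_nonempty drag_op uLp.
have [B _ HB] := clamp_selection K IO mI.
have [//|||] := HB u lam.
- apply: measurable_funS IO (Lp_mfun mOm lamLp) => //.
- apply: (ae_mono al) => x H Ix; have [phi] := H (IO x Ix).
  by rewrite !patchE mem_set// => Pphi ->; exists phi.
move=> lam' [m1 m2 m3 _]; exists lam'; split => //; by exists B.
Qed.

(** [Phi] sees only the square of u, so the drag is odd. This turns upper estimates of integrals
    into lower ones. *)
Lemma selection_opp I u lam : selection I u lam ->
  selection I (fun x => - u x) (fun x => - lam x).
Proof.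
move=> [ml [B lB] al]; split.
- exact: measurableT_comp.
- by exists B => x Ix; rewrite normrN lB.
- apply: (ae_mono al) => x H Ix; have [phi Pphi ->] := H Ix.
  by exists phi; rewrite ?sqrrN// !mulrN.
Qed.

Lemma selection_convex I u lam lam' (t : R) : I `<=` Om -> 0 <= t <= 1 ->
  selection I u lam -> selection I u lam' ->
  selection I u (fun x => t * lam x + (1 - t) * lam' x).
Proof.
move=> IO t01 [ml [B lB] al] [ml' [B' lB'] al']; split.
- by apply: measurable_funD; apply: measurable_funM => //; exact: measurable_cst.
- exists (t * B + (1 - t) * B') => x Ix; case/andP: t01 => t0 t1.
  apply: (le_trans (ler_normD _ _));
    rewrite !normrM (ger0_norm t0) (ger0_norm (_ : 0 <= 1 - t)) ?subr_ge0//.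
  by apply: lerD; apply: ler_wpM2l; rewrite ?subr_ge0 ?lB ?lB'.
- apply: (ae_mono (ae_conj al al')) => x [H H'] Ix.
  have [phi Pphi ->] := H Ix; have [phi' Pphi' ->] := H' Ix.
  exists (t * phi + (1 - t) * phi'); last by ring.
  have D0 : 0 <= D x by rewrite ltW// (drag_coef_gt0 drag_op)//; exact: IO.
  have a0 : 0 <= D x * u x ^+ 2 by rewrite mulr_ge0// sqr_ge0.
  move: Pphi Pphi'; rewrite -(drag_potential_subdiff drag_op a0).
  exact: clarke_subdiff_convex.
Qed.

(** Where u x is nonzero the multipliers are quotients and converge, and closedness of the Clarke
    subdifferential applies. Where u x = 0 they may fail to converge, but the growth bound forces y
    = 0. *)
Lemma drag_at_cluster (u_ : nat -> R -> R) u x (y_ : nat -> R) y : Om x ->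
  u_ n x @[n --> \oo] --> u x -> y_ n @[n --> \oo] --> y ->
  (forall n, drag_at (u_ n) x (y_ n)) -> drag_at u x y.
Proof.
move=> Ox cu cy H.
have D0 : 0 < D x by rewrite (drag_coef_gt0 drag_op).
have a0 v : 0 <= D x * v x ^+ 2 by rewrite mulr_ge0 ?sqr_ge0 ?(ltW D0).
(* At a zero of u any element of [Phi] is a valid witness; it remains to derive y = 0 from $|y_n|
   \le K |u_n(x)|$. *)
have [ux0|ux0] := eqVneq (u x) 0.
  have [phi Pphi] := drag_map_nonempty drag_op (a0 u).
  exists phi => //; rewrite ux0 !mulr0.
  have [B HB] : exists B, forall n, `|u_ n x| <= B.
    have : cvgn (fun n => u_ n x) by apply/cvg_ex; exists (u x).
    move=> /cvg_seq_bounded[M [_ HM]]; exists (`|M| + 1) => n.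
    by apply: HM => //; rewrite (le_lt_trans (ler_norm _))// ltrDl.
  have [c [C [c0 C0 HG]]] := drag_map_growth drag_op.
  pose K := C * (1 + (D x * B ^+ 2) `^ ((r - 2) / 2)) * D x.
  have B0 : 0 <= B by exact: le_trans (HB 0%N).
  have K0 : 0 <= K by rewrite mulr_ge0 ?(ltW D0)// mulr_ge0 ?(ltW C0)// addr_ge0 ?powR_ge0.
  have yK n : `|y_ n| <= K * `|u_ n x|.
    have [psi Ppsi ->] := H n.
    have psi0 := drag_map_ge0 drag_op (a0 _) Ppsi.
    have /andP[_ pC] := HG _ _ (a0 _) Ppsi.
    rewrite mulrA 2!normrM (ger0_norm psi0) (gtr0_norm D0) ler_wpM2r// ler_wpM2r ?(ltW D0)//.
    apply: (le_trans pC);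
      rewrite ler_pM2l// lerD2l ge0_ler_powR// ?nnegrE// ?mulr_ge0 ?sqr_ge0 ?(ltW D0)//.
    by rewrite ler_pM2l// sqr_le_norm.
  apply/eqP; rewrite -normr_le0;
    apply: (@ler_cvg_to _ _ eventually_filter _ (fun n => `|y_ n|) (fun n => K * `|u_ n x|)).
  - exact: cvg_norm.
  - rewrite -[X in _ --> X](mulr0 K); apply: cvgM; first exact: cvg_cst.
    by rewrite -(normr0 R) -ux0; exact: cvg_norm.
  - by near=> n; exact: yK.
have HH n : exists p, Phi (D x * u_ n x ^+ 2) p /\ y_ n = p * (D x * u_ n x).
  by have [p] := H n; exists p.
have [phi_ Hphi] := choice HH.
have Du0 : D x * u x != 0 by rewrite mulf_neq0// gt_eqF.
have cDu : D x * u_ n x @[n --> \oo] --> D x * u x by apply: cvgM => //; exact: cvg_cst.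
exists (y / (D x * u x)); last by rewrite divfK.
rewrite -(drag_potential_subdiff drag_op (a0 u)).
apply: (@clarke_subdiff_closed _ _ (fun n => D x * u_ n x ^+ 2) phi_).
- by apply: cvgM; [exact: cvg_cst|rewrite expr2; under eq_fun do rewrite expr2; exact: cvgM].
- have cq : y_ n / (D x * u_ n x) @[n --> \oo] --> y / (D x * u x).
    by apply: cvgM => //; exact: cvgV.
  apply: cvg_trans cq; apply: near_eq_cvg.
  have : \forall n \near \oo, D x * u_ n x != 0.
    by have := cvgr_neq0 _ cDu Du0; exact.
  apply: filterS => n nz; have [_ ->] := Hphi n.
  by rewrite mulfK.
- by near=> n; have [P _] := Hphi n; rewrite (drag_potential_subdiff drag_op (a0 (u_ n))).
Unshelve. all: by end_near. Qed.

Lemma bounded_integrable I lam B : I `<=` Om -> measurable I -> measurable_fun I lam ->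
  (forall x, I x -> `|lam x| <= B) -> mu.-integrable I (EFin \o lam).
Proof.
move=> IO mI ml lB.
have Ifin : (mu I < +oo)%E.
  by apply: le_lt_trans Om_fin; apply: le_measure; rewrite ?inE.
have i1 : mu.-integrable I (EFin \o (cst 1 : R -> R)).
  apply/integrableP; split; first by apply/measurable_EFinP; exact: measurable_cst.
  by rewrite /= normr1 integral_cst// mul1e.
apply: (le_integrable mI _ _ (integrable_scaler B mI i1)); first exact/measurable_EFinP.
by move=> x Ix /=; rewrite lee_fin mul1r (le_trans (lB x Ix))// ler_norm.
Qed.

Lemma selection_integrable I u lam : I `<=` Om -> measurable I ->
  selection I u lam -> mu.-integrable I (EFin \o lam).
Proof. by move=> IO mI [ml [B lB] _]; exact: bounded_integrable lB. Qed.

(** The limit is the pointwise lower limit of the truncated selections. It satisfies the drag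
    relation by [drag_at_cluster], and its integral is controlled as in Fatou's lemma. *)
Lemma selection_limit I (u_ : nat -> R -> R) u K m : I `<=` Om -> measurable I ->
  (forall n x, I x -> `|u_ n x| <= K) ->
  (forall x, I x -> u_ n x @[n --> \oo] --> u x) ->
  (forall n, exists2 lam, selection I (u_ n) lam & \int[mu]_(x in I) lam x <= m) ->
  exists2 lam, selection I u lam & \int[mu]_(x in I) lam x <= m.
Proof.
move=> IO mI uK cu H.
have [B B0 HB] := clamp_selection K IO mI.
have H' n : exists lam, [/\ measurable_fun I lam, forall x, I x -> `|lam x| <= B,
    {ae mu, forall x, I x -> drag_at (u_ n) x (lam x)} & \int[mu]_(x in I) lam x <= m].
  have [lam [ml _ al] im] := H n.
  have [lam' [ml' lB' al' E]] := HB _ _ (uK n) ml al.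
  by exists lam'; split => //; rewrite -(eq_Rintegral_ae mI ml ml' E).
have [lam_ Hlam] := choice H'.
pose lam x := lower_limit (fun n => lam_ n x).
have lB x n : I x -> `|lam_ n x| <= B by move=> Ix; have [_ b _ _] := Hlam n; exact: b.
have mg n : measurable_fun I (fun x => infs (fun k => lam_ k x) n).
  apply: measurable_fun_infs; last by move=> k; have [] := Hlam k.
  by move=> x Ix; apply: (@bounded_seq_has_lbound _ _ B) => k; exact: lB.
have cg x : I x -> infs (fun k => lam_ k x) n @[n --> \oo] --> lam x.
  by move=> Ix; apply: (@cvg_infs_lower_limit _ _ B) => k; exact: lB.
have ml : measurable_fun I lam.
  by apply: (measurable_fun_cvg mg) => x Ix; exact: cg.
have gB x n : I x -> `|infs (fun k => lam_ k x) n| <= B.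
  by move=> Ix; apply: infs_norm_le => k; exact: lB.
have iB : mu.-integrable I (EFin \o (cst B : R -> R)).
  by apply: (@bounded_integrable _ _ B) => // x _; rewrite ger0_norm.
exists lam.
  split => //.
    exists B => x Ix; apply: (ler_cvg_to (cvg_norm (cg x Ix)) (cvg_cst B)).
    by near=> n; exact: gB.
  have ae_all : {ae mu, forall x, forall n, I x -> drag_at (u_ n) x (lam_ n x)}.
    by apply: ae_foralln => n; have [] := Hlam n.
  apply: (ae_mono ae_all) => x Hx Ix.
  (* The subsequence depends on x, which is harmless: measurability of lam is already known and the
     relation is checked point by point. *)
  have [sigma [s_ge cs]] := lower_limit_subseq (fun n => lB x n Ix).
  apply: (@drag_at_cluster (fun k => u_ (sigma k)) u x (fun k => lam_ (sigma k) x)) => //.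
  - exact: IO.
  - exact: (cvg_subseq s_ge (cu x Ix)).
  - by move=> k; exact: Hx.
(* The tail infima lie below the selections, so their integrals are at most m, and they converge to
   lam under the constant bound B. *)
have cint := dominated_Rintegral mI mg cg iB (fun n x Ix => gB x n Ix).
apply: (ler_cvg_to cint (cvg_cst m)); near=> n.
have [mn bn _ im] := Hlam n; apply: le_trans im.
apply: le_Rintegral => //.
- by apply: (@bounded_integrable _ _ B) => // x Ix; exact: gB.
- exact: bounded_integrable bn.
- by move=> x Ix; apply: (@infs_le _ _ B) => // k; exact: lB.
Unshelve. all: by end_near. Qed.

(** For large u the lower growth bound gives phi >= c, so lam is at least c d u, which exceeds the
    value |m| / |I| needed for the integral. *)
Lemma selection_coercive I m : I `<=` Om -> measurable I -> (0 < mu I)%E ->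
  exists C : R, forall u lam, selection I u lam -> (forall x, I x -> C <= u x) ->
    m <= \int[mu]_(x in I) lam x.
Proof.
move=> IO mI I0.
have Ifin : mu I \is a fin_num.
  rewrite ge0_fin_numE//; apply: le_lt_trans Om_fin; apply: le_measure; rewrite ?inE//.
have l0 : 0 < fine (mu I) by rewrite fine_gt0// I0 -ge0_fin_numE.
set l := fine (mu I) in l0.
have [d [d' [d0 _ Dd]]] := drag_coef_bounds.
have [c [C0 [c0 _ HG]]] := drag_map_growth drag_op.
pose v : R := `|m| / l.
have v0 : 0 <= v by rewrite divr_ge0// ltW.
(* The summands ensure in turn u >= 1, d u >= 1 (whence D u^2 >= 1 and phi >= c), and c d u >= v. *)
pose C := 1 + d^-1 + v / (c * d).
have cd0 : 0 < c * d by rewrite mulr_gt0.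
have w0 : 0 <= v / (c * d) by rewrite divr_ge0// ltW.
have di0 : 0 < d^-1 by rewrite invr_gt0.
have C1 : 1 <= C by rewrite /C -addrA lerDl addr_ge0// ltW.
exists C => u lam [ml [B lB] al] Cu.
have lv : {ae mu, forall x, I x -> lam x = Num.max v (lam x)}.
  apply: (ae_mono al) => x Hx Ix; rewrite (max_idPr _)//.
  have [phi Pphi ->] := Hx Ix.
  have /andP[dD _] := Dd x (IO x Ix).
  have D0 : 0 < D x by exact: lt_le_trans dD.
  have Cux := Cu x Ix.
  have u1 : 1 <= u x by exact: le_trans Cux.
  have a1 : 1 <= D x * u x ^+ 2.
    have h1 : 1 <= d * u x.
      by rewrite -ler_pdivrMl// mulr1 (le_trans _ Cux)// /C; lra.
    apply: (le_trans h1); apply: ler_pM => //; [exact: ltW|exact: le_trans u1|].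
    by rewrite expr2 ler_peMl// (le_trans _ u1).
  have /andP[cphi _] := HG _ _ (le_trans ler01 a1) Pphi.
  have phic : c <= phi.
    apply: le_trans cphi; rewrite ler_peMr ?(ltW c0)//.
    apply: (@le_trans _ _ (1 `^ ((r - 2) / 2))); first by rewrite powR1.
    by rewrite ge0_ler_powR// nnegrE// (le_trans ler01 a1).
  have h2 : v <= c * d * u x.
    by rewrite -ler_pdivrMl// mulrC (le_trans _ Cux)// /C; lra.
  apply: (le_trans h2); rewrite -mulrA; apply: ler_pM => //; first exact: ltW.
    by rewrite mulr_ge0 ?(ltW d0)// (le_trans ler01 u1).
  by rewrite ler_wpM2r// (le_trans ler01 u1).
have mv : measurable_fun I (fun x => Num.max v (lam x)).
  by apply: measurable_maxr => //; exact: measurable_cst.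
rewrite (eq_Rintegral_ae mI ml mv lv).
have H : v * l <= \int[mu]_(x in I) Num.max v (lam x).
  rewrite -(Rintegral_cst mu mI v); apply: le_Rintegral => //.
  - by apply: (@bounded_integrable _ _ v) => // x _; rewrite ger0_norm.
  - apply: (@bounded_integrable _ _ (Num.max v B)) => // x Ix.
    have := lB x Ix; rewrite ler_norml => /andP[l1 l2].
    rewrite ger0_norm; last by rewrite le_max v0.
    by rewrite ge_max !le_max lexx l2 orbT.
  - by move=> x _; rewrite le_max lexx.
by apply: le_trans H; rewrite /v divfK ?gt_eqF// ler_norm.
Qed.

(** Let c0 be the supremum of A. Points of A tending to c0 yield a selection with integral at most
    m; beyond c0 every selection has integral above m, so approach from above yields one with
    integral at least m. Values of [Phi] are convex, so a combination reaches m. *)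
Lemma selection_integral I Q K m : I `<=` Om -> measurable I -> (0 < mu I)%E ->
  measurable_fun I Q -> (forall x, I x -> `|Q x| <= K) ->
  exists c lam, selection I (fun x => c + Q x) lam /\ \int[mu]_(x in I) lam x = m.
Proof.
move=> IO mI I0 mQ QK.
have [x0 Ix0] : exists x, I x.
  by apply: contrapT => N; move: I0; rewrite (_ : I = set0) ?measure0 ?ltxx//;
    apply/seteqP; split=> x // Ix; apply: N; exists x.
have K0 : 0 <= K by exact: le_trans (QK _ Ix0).
have mu_ c : measurable_fun I (fun x => c + Q x).
  by apply: measurable_funD => //; exact: measurable_cst.
have ub c x : I x -> `|c + Q x| <= `|c| + K.
  by move=> Ix; rewrite (le_trans (ler_normD _ _))// lerD2l QK.
have ex c := selection_exists IO mI (mu_ c) (ub c).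
pose A := [set c | exists2 lam, selection I (fun x => c + Q x) lam & \int[mu]_(x in I) lam x <= m].
have oppI u lam : selection I u lam ->
    \int[mu]_(x in I) (- lam x) = - \int[mu]_(x in I) lam x.
  move=> sl; rewrite -mulN1r -(RintegralZl _ mI (selection_integrable IO mI sl)).
  by apply: eq_Rintegral => x _; rewrite mulN1r.
have A0 : A !=set0.
  have [C HC] := selection_coercive (- m) IO mI I0.
  exists (- (C + K)); have [lam sl] := ex (- (C + K)).
  exists lam => //; rewrite -lerN2 -(oppI _ _ sl).
  apply: (HC _ _ (selection_opp sl)) => x Ix.
  by have := QK x Ix; rewrite ler_norml; lra.
have Aub : has_ubound A.
  (* Coercivity is a weak inequality; the level m + 1 makes it contradict an integral at most m. *)
  have [C HC] := selection_coercive (m + 1) IO mI I0.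
  exists (C + K) => c [lam sl im]; rewrite leNgt; apply/negP => Cc.
  suff : m + 1 <= m by rewrite gerDl ler10.
  apply: le_trans im; apply: (HC _ _ sl) => x Ix.
  by have := QK x Ix; rewrite ler_norml; lra.
pose c0 := sup A.
have near_bound (c : R) : `|c - c0| <= 1 -> forall x, I x -> `|c + Q x| <= `|c0| + 1 + K.
  move=> cc x Ix; apply: (le_trans (ub c x Ix)); rewrite lerD2r.
  by rewrite -lerBlDl (le_trans (lerB_dist _ _)).
have lim_c (c_ : nat -> R) : (forall n, `|c_ n - c0| <= n.+1%:R^-1) ->
    forall x, c_ n + Q x @[n --> \oo] --> c0 + Q x.
  move=> Hc x; apply: cvgD; last exact: cvg_cst.
  apply/cvgrPdist_lt => e e0; near=> n; rewrite distrC (le_lt_trans (Hc n))//.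
  by near: n; exact: near_natSinv.
have inv1 n : (n.+1%:R^-1 : R) <= 1 by rewrite invf_le1// ler1n.
have [lam1 s1 i1] : exists2 lam, selection I (fun x => c0 + Q x) lam & \int[mu]_(x in I) lam x <= m.
  have Hc n : exists c, A c /\ `|c - c0| <= n.+1%:R^-1.
    have n0 : 0 < (n.+1%:R^-1 : R) by rewrite invr_gt0.
    have [c Ac cl] := sup_adherent n0 (conj A0 Aub).
    exists c; split => //; rewrite ler0_norm ?subr_le0;
      first by rewrite opprB lerBlDl -lerBlDr ltW.
    exact: ub_le_sup.
  have [c_ Hc_] := choice Hc.
  apply: (@selection_limit I (fun n x => c_ n + Q x) _ (`|c0| + 1 + K)) => //.
  - by move=> n; apply: near_bound; have [_ /le_trans] := Hc_ n; apply.
  - by move=> x _; apply: lim_c => n; have [] := Hc_ n.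
  - by move=> n; have [] := Hc_ n.
have [lam2 s2 i2] : exists2 lam, selection I (fun x => c0 + Q x) lam & m <= \int[mu]_(x in I) lam x.
  pose c_ n := c0 + n.+1%:R^-1.
  have Hc n : `|c_ n - c0| <= n.+1%:R^-1 by rewrite /c_ addrC addKr ger0_norm.
  (* The limit lemma gives upper bounds only, so it is applied to the negated velocities with -m. *)
  have [|||lam sl im] := @selection_limit I (fun n x => - (c_ n + Q x)) (fun x => - (c0 + Q x)) (`|c0| + 1 + K) (- m) IO mI.
  - by move=> n x Ix; rewrite normrN; apply: near_bound => //; exact: le_trans (Hc n) _.
  - by move=> x _; apply: cvgN; exact: lim_c.
  - move=> n; have [lam sl] := ex (c_ n).
    exists (fun x => - lam x); first exact: selection_opp.
    rewrite (oppI _ _ sl) lerN2 leNgt; apply/negP => im.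
    have : c_ n <= c0 by apply: ub_le_sup => //; exists lam => //; exact: ltW.
    by rewrite /c_ gerDl leNgt invr_gt0 ltr0n.
  exists (fun x => - lam x); last by rewrite (oppI _ _ sl) lerNr.
  have := selection_opp sl; by under [X in selection _ X]eq_fun do rewrite opprK.
pose j1 := \int[mu]_(x in I) lam1 x; pose j2 := \int[mu]_(x in I) lam2 x.
have [j12|j12] := eqVneq j1 j2.
  by exists c0, lam1; split => //; apply/eqP; rewrite eq_le i1/= -/j1 j12.
have j12' : 0 < j2 - j1 by rewrite subr_gt0 lt_neqAle j12 (le_trans i1 i2).
(* The weight that solves t j1 + (1 - t) j2 = m; it lies in [0, 1] because j1 <= m <= j2. *)
pose t := (j2 - m) / (j2 - j1).
have t01 : 0 <= t <= 1.
  rewrite /t divr_ge0 ?(ltW j12') ?subr_ge0//=.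
  by rewrite ler_pdivrMr// mul1r lerD2l lerN2.
exists c0, (fun x => t * lam1 x + (1 - t) * lam2 x); split; first exact: selection_convex.
have I1 := selection_integrable IO mI s1; have I2 := selection_integrable IO mI s2.
rewrite RintegralD//; last 2 first.
- by have := integrable_scaler t mI I1; under eq_fun do rewrite /= mulrC.
- by have := integrable_scaler (1 - t) mI I2; under eq_fun do rewrite /= mulrC.
rewrite !RintegralZl// -/j1 -/j2 /t.
by field; rewrite gt_eqF.
Unshelve. all: by end_near. Qed.

Lemma selection_drag I u lam : 0 < s -> I `<=` Om -> measurable I ->
  selection I u lam -> drag D Phi I s u lam.
Proof.
move=> s0 IO mI [ml [B lB] al]; split => //.
apply: (@bounded_Lp _ _ _ B) => //.
by apply: le_lt_trans Om_fin; apply: le_measure; rewrite ?inE.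
Qed.

End DragSelections.

(** * Gluing over the components *)

Section FiniteSums.
Context d (T : measurableType d) (R : realType).
Variable mu : {measure set T -> \bar R}.

Lemma Rintegral_sum (D : set T) (J : Type) (f : J -> T -> R) (s : seq J) :
  measurable D -> (forall j, mu.-integrable D (EFin \o f j)) ->
  \int[mu]_(x in D) (\sum_(j <- s) f j x) = \sum_(j <- s) \int[mu]_(x in D) f j x.
Proof.
move=> mD intf; rewrite /Rintegral.
under eq_integral do rewrite -sumEFin.
have fin j : (\int[mu]_(x in D) (f j x)%:E \is a fin_num)%E.
  exact: (integrable_fin_num mD (intf j)).
rewrite integral_sum//; elim: s => [|j s ih]; first by rewrite !big_nil.
rewrite !big_cons fineD ?ih//.
elim: s {ih} => [|i s ih]; first by rewrite big_nil.
by rewrite big_cons fin_numD ih andbT.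
Qed.

End FiniteSums.

(** * Integrals against the counting measure *)

Section Counting.
Context {R : realType}.
Implicit Types (A : set R) (f : R -> R) (t : seq R).

Lemma Vol0_set1 (x : R) : Vol0 [set x] = 1%E.
Proof. by rewrite /Vol0/= /counting asboolT// fset_set1 finmap.cardfs1. Qed.

Lemma Vol0_eq0 A : finite_set A -> (Vol0 A == 0)%E = (A == set0).
Proof.
move=> fA; rewrite /Vol0/= /counting asboolT// eqe pnatr_eq0 finmap.cardfs_eq0.
apply/eqP/eqP => [E|->]; last by rewrite fset_set0.
by rewrite -(fset_setK fA) E set_fset0.
Qed.

Lemma patch_seq_sum A f t : uniq t -> A `<=` [set` t] ->
  f \_ A = (fun x => \sum_(y <- t) (if y \in A then f y * \1_[set y] x else 0)).
Proof.
move=> ut At; apply/funext => x; rewrite patchE.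
case: ifPn => xA.
  have xt : x \in t by apply: At; rewrite inE in xA.
  rewrite (bigD1_seq x)//= xA indicE mem_set// mulr1 big1 ?addr0// => y yx.
  case: ifP => // _; rewrite indicE memNset ?mulr0// => /esym/eqP.
  by rewrite (negbTE yx).
rewrite big1// => y _; case: ifPn => // yA; rewrite indicE memNset ?mulr0// => xy.
by move: xA; rewrite xy yA.
Qed.

(** The extension of f by 0 is a finite combination of indicators of points, each of counting mass
    1. *)
Lemma Rintegral_counting A f t : uniq t -> A `<=` [set` t] ->
  \int[Vol0]_(x in A) f x = \sum_(y <- t) (if y \in A then f y else 0).
Proof.
move=> ut At; rewrite Rintegral_mkcond (patch_seq_sum f ut At).
have m1 y : measurable ([set y] : set (measurableTypeR R)) by exact: measurable_set1.
have i1 y : (Vol0 : {measure set (measurableTypeR R) -> \bar R}).-integrable setT (EFin \o (\1_[set y] : R -> R)).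
  apply/integrableP; split; first by apply/measurable_EFinP; exact: measurable_indic.
  rewrite (_ : (\int[_]_x _)%E = (\int[Vol0]_x (\1_[set y] x)%:E)%E); last first.
    by apply: eq_integral => x _; rewrite /= ger0_norm.
  by rewrite integral_indic// setIT -/(Vol0 [set y]) Vol0_set1 ltry.
have I1 y : \int[Vol0]_x (\1_[set y] x : R) = 1.
  by rewrite /Rintegral integral_indic// setIT -/(Vol0 [set y]) Vol0_set1.
rewrite (@Rintegral_sum _ (measurableTypeR R) _ Vol0 _ _ (fun y x => if y \in A then f y * \1_[set y] x else 0))//.
- apply: eq_bigr => y _; case: ifP => _; first by rewrite RintegralZl// I1 mulr1.
  by rewrite /Rintegral integral0.
- move=> y; case: (y \in A).
    have := integrableZl measurableT (f y) (i1 y).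
    by under eq_fun do rewrite -EFinM.
  exact: integrable0.
Qed.

End Counting.

(** * Functions defined component by component *)

Section PiecewiseDefinition.
Context {R : realType}.
Notation mu := (@lebesgue_measure R).
Variables (Om : set (measurableTypeR R)) (s : seq R) (e : R -> R).
Hypothesis Om_comp : components Om s e.
Implicit Types (a x : R) (f g h : R -> R).

Lemma lebesgue_measure_oo (a b : R) : a < b -> mu `]a, b[%classic = (b - a)%:E.
Proof. by move=> ab; rewrite lebesgue_measure_itv/= lte_fin ab EFinB. Qed.

Lemma lebesgue_measure_oo_fin (a b : R) : (mu `]a, b[%classic < +oo)%E.
Proof.
by rewrite lebesgue_measure_itv/= lte_fin; case: ifP => _; rewrite -?EFinB ltry.
Qed.

(** Closed intervals are tested, so that boundary points are attached to their component too. The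
    default 0 occurs only off the closure of [Om], where values do not matter. *)
Definition left_end x : R := head 0 [seq a <- s | a <= x <= e a].

Definition piecewise (u_ : R -> R -> R) : R -> R := fun x => u_ (left_end x) x.

Lemma left_end_uniq a a' x : a \in s -> a' \in s -> a <= x <= e a ->
  a' <= x <= e a' -> a = a'.
Proof.
move=> as_ a's /andP[ax xa] /andP[a'x xa'].
have [aa'|aa'|//] := ltgtP a a'.
  by have := comp_sep Om_comp as_ a's aa'; rewrite ltNge (le_trans a'x xa).
by have := comp_sep Om_comp a's as_ aa'; rewrite ltNge (le_trans ax xa').
Qed.

Lemma left_endE a x : a \in s -> a <= x <= e a -> left_end x = a.
Proof.
move=> as_ ax; rewrite /left_end.
have : a \in [seq a <- s | a <= x <= e a] by rewrite mem_filter ax.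
case E : [seq a <- s | a <= x <= e a] => [//|b t] _ /=.
have : b \in [seq a <- s | a <= x <= e a] by rewrite E inE eqxx.
by rewrite mem_filter => /andP[bx bs]; exact: left_end_uniq bx ax.
Qed.

Lemma piecewiseE (u_ : R -> R -> R) a x : a \in s -> a <= x <= e a -> piecewise u_ x = u_ a x.
Proof. by move=> as_ ax; rewrite /piecewise (left_endE as_ ax). Qed.

Lemma component_sub a : a \in s -> `]a, e a[ `<=` Om.
Proof. by move=> as_ x /=; rewrite in_itv/= => ax; apply/(comp_mem Om_comp); exists a. Qed.

Lemma patch_components f : f \_ Om = (fun x => \sum_(a <- s) (f \_ `]a, e a[) x).
Proof.
apply/funext => x; rewrite patchE; case: ifPn => [xO|xO].
  have [a as_ ax] : exists2 a, a \in s & a < x < e a.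
    by apply/(comp_mem Om_comp); rewrite inE in xO.
  have xa : a <= x <= e a by case/andP: ax => ? ?; rewrite !ltW.
  rewrite (bigD1_seq a)//=; last exact: comp_uniq Om_comp.
  rewrite patchE mem_set/= ?in_itv//= big_seq_cond big1 ?addr0// => b /andP[bs ba].
  rewrite patchE memNset//= in_itv/= => /andP[bx xb].
  move/eqP: ba; apply; apply: (left_end_uniq bs as_ _ xa).
  by rewrite !ltW.
rewrite big_seq big1// => a as_; rewrite patchE memNset// => xa.
by move/negP: xO; apply; rewrite inE; exact: component_sub xa.
Qed.

Lemma measurable_components : measurable Om.
Proof.
have -> : Om = \big[setU/set0]_(a <- s) (`]a, e a[%classic : set (measurableTypeR R)).
  apply/seteqP; split=> [x /(comp_mem Om_comp)[a as_ ax]|x].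
    by rewrite -bigcup_seq; exists a => //=; rewrite in_itv.
  by rewrite -bigcup_seq => -[a /= as_]; exact: component_sub.
by apply: bigsetU_measurable => a _; exact: measurable_itv.
Qed.

Lemma components_finite_measure : (mu Om < +oo)%E.
Proof.
have -> : Om = \big[setU/set0]_(a <- s) (`]a, e a[%classic : set (measurableTypeR R)).
  apply/seteqP; split=> [x /(comp_mem Om_comp)[a as_ ax]|x].
    by rewrite -bigcup_seq; exists a => //=; rewrite in_itv.
  by rewrite -bigcup_seq => -[a /= as_]; exact: component_sub.
elim: s => [|a t ih]; first by rewrite big_nil measure0.
have m1 : measurable (`]a, e a[%classic : set (measurableTypeR R)) by exact: measurable_itv.
have m2 : measurable (\big[setU/set0]_(b <- t) `]b, e b[%classic : set (measurableTypeR R)).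
  by apply: bigsetU_measurable => b _; exact: measurable_itv.
rewrite big_cons; have := @measureU2 _ _ _ mu _ _ m1 m2.
move=> /le_lt_trans; apply.
apply: lte_add_pinfty ih.
exact: lebesgue_measure_oo_fin.
Qed.

Lemma Rintegral_components f : mu.-integrable Om (EFin \o f) ->
  \int[mu]_(x in Om) f x = \sum_(a <- s) \int[mu]_(x in `[a, e a]) f x.
Proof.
move=> iF; rewrite Rintegral_mkcond patch_components.
have mO := measurable_components.
have intf a : mu.-integrable setT (EFin \o ((f \_ Om) \_ `]a, e a[)).
  apply: integrable_patch; first exact: measurable_itv.
  by apply: integrableS (integrable_patch mO iF).
transitivity (\int[mu]_x \sum_(a <- s) ((f \_ Om) \_ `]a, e a[) x).
  apply: eq_Rintegral => x _; rewrite big_seq [RHS]big_seq; apply: eq_bigr => a as_.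
  rewrite !patchE; case: ifPn => // xa; rewrite ifT// inE.
  by apply: component_sub as_ _ _; rewrite inE in xa.
rewrite Rintegral_sum// big_seq [RHS]big_seq; apply: eq_bigr => a as_.
have mJ : measurable (`]a, e a[%classic : set (measurableTypeR R)) by exact: measurable_itv.
rewrite -Rintegral_oo_cc; last exact: (integrableS mO mJ (component_sub as_) iF).
rewrite [RHS]Rintegral_mkcond; apply: eq_Rintegral => x _.
rewrite !patchE; case: ifPn => // xa; rewrite ifT// inE.
by apply: component_sub as_ _ _; rewrite inE in xa.
Qed.

Lemma ae_components (P : R -> Prop) :
  (forall a, a \in s -> {ae mu, forall x, `]a, e a[%classic x -> P x}) ->
  {ae mu, forall x, Om x -> P x}.
Proof.
move=> H.
have {}H : {ae mu, forall x, forall a, a \in s -> `]a, e a[%classic x -> P x}.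
  elim: (s) H => [|a t ih] H.
    by apply: (ae_mono (P := fun=> True)) => //; apply: aeW.
  have H1 := H a (mem_head _ _).
  have H2 := ih (fun b bt => H b (mem_behead (s := a :: t) bt)).
  apply: (ae_mono (ae_conj H1 H2)) => x [h1 h2] b.
  by rewrite inE => /predU1P[->|]; [exact: h1|exact: h2].
apply: (ae_mono H) => x Hx /(comp_mem Om_comp)[a as_ ax].
by apply: (Hx a as_); rewrite /= in_itv.
Qed.

Lemma Lp_piecewise (p : R) (u_ : R -> R -> R) : 1 <= p ->
  (forall a, a \in s -> Lp Vol1 `]a, e a[ p (u_ a)) -> Lp Vol1 Om p (piecewise u_).
Proof.
move=> p1 H; rewrite /Lp patch_components.
have p1' : (1 <= p%:E)%E by rewrite lee_fin.
have [L0 LD] := Lfun_addr_closed Vol1 p1'.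
have : forall t, {subset t <= s} ->
    (fun x => \sum_(a <- t) (piecewise u_ \_ `]a, e a[) x) \in Lfun Vol1 p%:E.
  elim=> [|a t ih] ts.
    have -> : (fun x => \sum_(a <- [::]) (piecewise u_ \_ `]a, e a[) x) = 0
      by apply/funext => x; rewrite big_nil.
    exact: L0.
  have -> : (fun x => \sum_(b <- a :: t) (piecewise u_ \_ `]b, e b[) x) = (u_ a \_ `]a, e a[)
     + (fun x => \sum_(a <- t) (piecewise u_ \_ `]a, e a[) x).
    apply/funext => x; rewrite big_cons; congr (_ + _).
    rewrite !patchE; case: ifPn => // xa; apply: piecewiseE; first by apply: ts;
      rewrite mem_head.
    by move: xa; rewrite inE/= in_itv/= => /andP[? ?]; rewrite !ltW.
  apply: LD; first by apply: H; apply: ts; rewrite mem_head.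
  by apply: ih => b bt; apply: ts; rewrite inE bt orbT.
exact.
Qed.

(** The closure is covered by finitely many closed intervals, and continuity on two closed sets
    passes to their union. *)
Lemma continuous_piecewise (u_ : R -> R -> R) : (forall a, a \in s -> {within `[a, e a], continuous (u_ a)}) ->
  {within closure Om, continuous (piecewise u_)}.
Proof.
move=> H.
pose C (t : seq R) := \bigcup_(a in [set` t]) `[a, e a]%classic.
have sub : closure Om `<=` C s.
  move=> x cx; have [Ox|nOx] := pselect (Om x).
    have [a as_ ax] := (comp_mem Om_comp x).1 Ox.
    by exists a => //=; rewrite in_itv/=; case/andP: ax => ? ?; rewrite !ltW.
  have : boundary Om x by split => // /interior_subset.
  move=> /(comp_boundary Om_comp)[a as_ xE]; exists a => //=; rewrite in_itv/=.
  by have := ltW (comp_lt Om_comp as_); case: xE => -> ->; rewrite lexx.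
apply: (continuous_subspaceW sub).
suff : forall t, {subset t <= s} -> {within C t, continuous (piecewise u_)} by exact.
elim=> [|a t ih] ts.
  by rewrite /C bigcup0//; exact: continuous_subspace0.
have -> : C (a :: t) = `[a, e a]%classic `|` C t.
  apply/seteqP; split=> [x [b /=]|x].
    by rewrite inE => /predU1P[->|bt] xb; [left|right; exists b].
  by case=> [xa|[b /= bt xb]]; [exists a => //=; rewrite mem_head|exists b => //=;
    rewrite inE bt orbT].
apply: withinU_continuous.
- exact: interval_closed.
- by apply: closed_bigcup; [exact: finite_seq|move=> b _; exact: interval_closed].
- apply: (@subspace_eq_continuous _ _ _ (u_ a)).
    move=> x; rewrite mem_itvcc => xa; rewrite /from_subspace (piecewiseE _ _ xa)//.
    by apply: ts; rewrite mem_head.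
  by apply: H; apply: ts; rewrite mem_head.
- by apply: ih => b bt; apply: ts; rewrite inE bt orbT.
Qed.

End PiecewiseDefinition.

(** * Solution of the problem *)

Section OneComponent.
Context {R : realType}.
Notation mu := (@lebesgue_measure R).
Implicit Types (a b c x : R) (f g h u : R -> R).

Lemma ae_point a b (P : R -> Prop) : a < b ->
  {ae mu, forall x, `]a, b[%classic x -> P x} -> exists2 x, a < x < b & P x.
Proof.
move=> ab H; apply: contrapT => N.
have neg : mu.-negligible (`]a, b[%classic : set (measurableTypeR R)).
  apply: negligibleS H => x xI /= /(_ xI) Px.
  by apply: N; exists x => //; move: xI; rewrite /= in_itv.
have mI : measurable (`]a, b[%classic : set (measurableTypeR R)) by exact: measurable_itv.
have : mu `]a, b[%classic = 0%E by exact: (measure_negligible mI neg).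
by rewrite lebesgue_measure_oo// => -[]; lra.
Qed.

Lemma integrable_ext (I : set (measurableTypeR R)) f g :
  mu.-integrable I (EFin \o f) -> f =1 g -> mu.-integrable I (EFin \o g).
Proof. by move=> iF /funext <-. Qed.

Lemma Rintegral_cst_cc a b c : a < b -> \int[mu]_(x in `[a, b]) c = c * (b - a).
Proof.
move=> ab; have mJ : measurable (`[a, b]%classic : set (measurableTypeR R))
  by exact: measurable_itv.
rewrite (Rintegral_cst mu mJ); congr (_ * _).
have E : mu `[a, b]%classic = (b - a)%:E.
  by rewrite lebesgue_measure_itv/= lte_fin ab EFinB.
exact: (congr1 fine E).
Qed.

Lemma primitive_cst a b c g : mu.-integrable `[a, b] (EFin \o g) ->
  primitive a b (fun x => c + \int[mu]_(t in `[a, x]) g t) g.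
Proof. by move=> ig; split => // x _; rewrite set_itv1 Rintegral_set1 addr0. Qed.

Lemma eq_primitive a b h g g' : (forall x, a <= x <= b -> g x = g' x) ->
  primitive a b h g -> primitive a b h g'.
Proof.
move=> gg' [ig hg]; split.
  by apply: eq_integrable ig => // x; rewrite mem_itvcc => /gg' /= ->.
move=> x /[dup] /andP[ax xb] /hg ->; congr (_ + _); apply: eq_Rintegral => t.
by rewrite mem_itvcc => /andP[at' tx]; rewrite gg'// at' (le_trans tx).
Qed.

(** Both representatives agree with psi at some common point, and two primitives of g that agree
    once agree everywhere. This makes the trace independent of the representative. *)
Lemma trace_eq a b h h' g psi : a < b -> primitive a b h g -> primitive a b h' g ->
  {ae mu, forall x, `]a, b[%classic x -> psi x = h x} ->
  {ae mu, forall x, `]a, b[%classic x -> psi x = h' x} ->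
  forall x, a <= x <= b -> h x = h' x.
Proof.
move=> ab [_ hg] [_ hg'] hE hE'.
have [x0 /andP[ax xb] E] : exists2 x, a < x < b & psi x = h x /\ psi x = h' x.
  apply: ae_point => //; apply: (ae_mono (ae_conj hE hE')) => x [H H'] Ix.
  by split; [exact: H|exact: H'].
have x0I : a <= x0 <= b by rewrite !ltW.
have ha : h a = h' a.
  by case: E => E1 E2; have := E2; rewrite E1 hg// hg'// => /addIr.
by move=> x xI; rewrite hg// hg'// ha.
Qed.

Variables (Om : set (measurableTypeR R)) (r s : R) (D : R -> R)
  (Phi : R -> set R) (Psi : R -> R).
Hypotheses (mOm : measurable Om) (Om_fin : (mu Om < +oo)%E)
  (r_ge2 : 2 <= r) (s_gt0 : 0 < s) (drag_op : dissipative_drag Om r s D Phi Psi).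

(** A and B tell whether the left and right ends carry a pressure condition; the remaining ends
    prescribe u. The two free constants, in u and in P, together with k when neither end is in [Sp],
    match the conditions in each of the four cases. *)
Lemma component_problem a b (q F : R -> R) (A B : bool) (ua ub : R) :
  a < b -> `]a, b[ `<=` Om ->
  mu.-integrable `[a, b] (EFin \o q) -> mu.-integrable `[a, b] (EFin \o F) ->
  exists (u lam P : R -> R) (k : R),
  [/\ [/\ primitive a b u (fun x => q x + k), A || B -> k = 0,
          ~~ A -> u a = ua & ~~ B -> u b = ub],
      drag D Phi `]a, b[ s u lam,
      primitive a b P (fun x => F x - lam x) &
      [/\ A -> P a = 0, B -> P b = 0 &
          ~~ (A || B) -> \int[mu]_(x in `[a, b]) P x = 0]].
Proof.
move=> ab IO iq iF.
have mI : measurable (`]a, b[%classic : set (measurableTypeR R)) by exact: measurable_itv.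
have mJ : measurable (`[a, b]%classic : set (measurableTypeR R)) by exact: measurable_itv.
have I0 : (0 < mu `]a, b[)%E by rewrite lebesgue_measure_oo// lte_fin subr_gt0.
have IJ : `]a, b[%classic `<=` `[a, b]%classic by exact: subset_itv_oo_cc.
have i1 : mu.-integrable `[a, b] (EFin \o (cst 1 : R -> R)).
  exact: (continuous_compact_integrable (@segment_compact R a b) (continuous_subspaceT (@cst_continuous _ _ _))).
have iqk k : mu.-integrable `[a, b] (EFin \o (fun x => q x + k)).
  by apply: (integrable_ext (integrable_addR mJ iq (integrable_scaler k mJ i1))) => x;
    rewrite /= mul1r.
have facts k c : let u := fun x => c + \int[mu]_(t in `[a, x]) (q t + k) in
    [/\ primitive a b u (fun x => q x + k), measurable_fun (`]a, b[%classic : set (measurableTypeR R)) u &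
      exists M : R, forall x, `]a, b[%classic x -> `|u x| <= M].
  move=> u; have pu : primitive a b u (fun x => q x + k) by exact: primitive_cst.
  split => //; first exact: measurable_funS IJ (primitive_mfun (ltW ab) pu).
  have [M HM] := primitive_bounded (ltW ab) pu; exists M => x /= /IJ /=.
  by rewrite in_itv/=; exact: HM.
have iG u lam : selection D Phi `]a, b[ u lam -> mu.-integrable `[a, b] (EFin \o (fun x => F x - lam x)).
  move=> sl; have il := integrable_oo_cc (selection_integrable mOm Om_fin IO mI sl).
  by apply: (integrable_ext (integrable_addR mJ iF (integrable_scaler (-1) mJ il))) => x;
    rewrite mulrN1.
have ex k c : exists lam, selection D Phi `]a, b[ (fun x => c + \int[mu]_(t in `[a, x]) (q t + k)) lam.
  have [_ mu_ [M uM]] := facts k c.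
  exact: (selection_exists mOm Om_fin r_ge2 drag_op IO mI mu_ uM).
have ua0 k c : c + \int[mu]_(t in `[a, a]) (q t + k) = c.
  by rewrite set_itv1 Rintegral_set1 addr0.
case: A; case: B => /=.
(* Both ends carry pressure: P a = 0 fixes P, so P b = 0 demands that lam and F have equal
   integrals, which the constant in u achieves. *)
- have [_ mQ [M QM]] := facts 0 0.
  have [c [lam [sl ilam]]] := selection_integral mOm Om_fin r_ge2 drag_op
    (\int[mu]_(x in `]a, b[) F x) IO mI I0 mQ QM.
  have sl' : selection D Phi `]a, b[ (fun x => c + \int[mu]_(t in `[a, x]) (q t + 0)) lam.
    by move: sl; congr selection; apply/funext => x; rewrite add0r.
  have [pu _ _] := facts 0 c.
  exists (fun x => c + \int[mu]_(t in `[a, x]) (q t + 0)), lam,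
    (fun x => 0 + \int[mu]_(t in `[a, x]) (F t - lam t)), 0; split => //.
  + exact: (selection_drag mOm Om_fin).
  + by apply: primitive_cst; exact: iG sl'.
  + split => // _; first by rewrite set_itv1 Rintegral_set1 addr0.
    have il := selection_integrable mOm Om_fin IO mI sl'.
    rewrite add0r RintegralB//; last exact: integrable_oo_cc.
    rewrite -(Rintegral_oo_cc il) -Rintegral_oo_cc ?ilam ?subrr//.
    exact: (integrableS mJ mI IJ iF).
(* Pressure on the left only: u is integrated back from its value at b. *)
- pose c := ub - \int[mu]_(t in `[a, b]) (q t + 0).
  have [lam sl] := ex 0 c; have [pu _ _] := facts 0 c.
  exists (fun x => c + \int[mu]_(t in `[a, x]) (q t + 0)), lam,
    (fun x => 0 + \int[mu]_(t in `[a, x]) (F t - lam t)), 0; split => //.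
  + by split => // _; rewrite /c subrK.
  + exact: (selection_drag mOm Om_fin).
  + by apply: primitive_cst; exact: iG sl.
  + by split => // _; rewrite set_itv1 Rintegral_set1 addr0.
- have [lam sl] := ex 0 ua; have [pu _ _] := facts 0 ua.
  exists (fun x => ua + \int[mu]_(t in `[a, x]) (q t + 0)), lam,
    (fun x => (- (\int[mu]_(t in `[a, b]) (F t - lam t))) + \int[mu]_(t in `[a, x]) (F t - lam t)), 0; split => //.
  + exact: (selection_drag mOm Om_fin).
  + by apply: primitive_cst; exact: iG sl.
  + by split => // _; rewrite addNr.
- have ba0 : b - a != 0 by rewrite subr_eq0 gt_eqF.
  (* Velocity is prescribed at both ends, and k spreads the mismatch between the flux ub - ua and
     the source q evenly over the interval. *)
  pose k := (ub - ua - \int[mu]_(t in `[a, b]) q t) / (b - a).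
  have [lam sl] := ex k ua; have [pu _ _] := facts k ua.
  have iP c := primitive_cst c (iG _ _ sl).
  pose m := \int[mu]_(x in `[a, b]) \int[mu]_(t in `[a, x]) (F t - lam t).
  (* This constant makes the mean of the pressure zero. *)
  pose c := - (m / (b - a)).
  exists (fun x => ua + \int[mu]_(t in `[a, x]) (q t + k)), lam,
    (fun x => c + \int[mu]_(t in `[a, x]) (F t - lam t)), k; split => //.
  + split => // _.
    have ick : mu.-integrable `[a, b] (EFin \o (cst k : R -> R)).
      by apply: (integrable_ext (integrable_scaler k mJ i1)) => x; rewrite /= mul1r.
    rewrite RintegralD// Rintegral_cst_cc//.
    by rewrite /k; field.
  + exact: (selection_drag mOm Om_fin).
  + split => // _.
    have iPi : mu.-integrable `[a, b] (EFin \o (fun x => \int[mu]_(t in `[a, x]) (F t - lam t))).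
      by apply: (integrable_ext (primitive_integrableM (ltW ab) (iP 0) i1)) => x;
        rewrite /= mul1r add0r.
    have ic : mu.-integrable `[a, b] (EFin \o (cst c : R -> R)).
      by apply: (integrable_ext (integrable_scaler c mJ i1)) => x; rewrite /= mul1r.
    rewrite RintegralD// -/m.
    rewrite Rintegral_cst_cc//.
    by rewrite /c; field.
Qed.

End OneComponent.

(** * Sobolev functions and boundary sums on the union of components *)

Section PiecewiseSobolev.
Context {R : realType}.
Notation mu := (@lebesgue_measure R).
Variables (Om : set R) (s : seq R) (e : R -> R).
Hypotheses (Om_open : open Om) (Om_comp : components Om s e).
Implicit Types (a x : R) (f g h : R -> R).

Let mO : measurable (Om : set (measurableTypeR R)).
Proof. exact: measurable_components Om_comp. Qed.

Let Ofin : (mu Om < +oo)%E.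
Proof. exact: components_finite_measure Om_comp. Qed.

Lemma component_ends_out a : a \in s -> ~ Om a /\ ~ Om (e a).
Proof.
move=> as_; split; apply/((open_boundary _ Om_open).1 _).2;
  by apply/(comp_boundary Om_comp); exists a; [|left + right].
Qed.

Lemma integrable_components f :
  (forall a, a \in s -> mu.-integrable `[a, e a] (EFin \o f)) ->
  mu.-integrable Om (EFin \o f).
Proof.
move=> H; apply/(integrable_mkcond _ mO).2; rewrite restrict_EFin.
rewrite (patch_components Om_comp).
have : forall t, {subset t <= s} ->
    mu.-integrable setT (EFin \o (fun x => \sum_(a <- t) (f \_ `]a, e a[) x)).
  elim=> [|a t ih] ts.
    apply: (@integrable_ext _ _ (cst 0)); last by move=> x; rewrite big_nil.
    exact: integrable0.
  have i1 : mu.-integrable setT (EFin \o (f \_ `]a, e a[)).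
    apply: integrable_patch; first exact: measurable_itv.
    apply: integrableS (H a (ts a (mem_head a t))) => //; exact: subset_itv_oo_cc.
  have i2 := ih (fun b bt => ts b (mem_behead (s := a :: t) bt)).
  apply: (integrable_ext (integrable_addR measurableT i1 i2)) => x.
  by rewrite big_cons.
by apply.
Qed.

(** A test function has its support inside [Om], so it vanishes at all ends, and integration by
    parts on each component leaves no boundary terms. *)
Lemma sobolev_piecewise (p : R) (psi_ : R -> R -> R) dpsi : 1 <= p ->
  Lp Vol1 Om p dpsi -> (forall a, a \in s -> primitive a (e a) (psi_ a) dpsi) ->
  sobolev_deriv Om p (piecewise s e psi_) dpsi.
Proof.
move=> p1 dL H; have p0 : 0 < p by exact: lt_le_trans p1.
have psiL : Lp Vol1 Om p (piecewise s e psi_).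
  apply: (Lp_piecewise Om_comp p1) => a as_.
  have ae_ := ltW (comp_lt Om_comp as_).
  have [M HM] := primitive_bounded ae_ (H a as_).
  apply: (@bounded_Lp _ _ _ M) => //.
  - exact: lebesgue_measure_oo_fin.
  - apply: measurable_funS (primitive_mfun ae_ (H a as_)); first exact: measurable_itv.
    exact: subset_itv_oo_cc.
  - by move=> x /=; rewrite in_itv/= => /andP[ax xa]; apply: HM; rewrite !ltW.
split => // phi [sphi cphi sub].
have ephi a : a \in s -> phi a = 0 /\ phi (e a) = 0.
  move=> as_; have [na ne] := component_ends_out as_.
  by split; apply: contrapT => /eqP nz; [apply: na|apply: ne];
    apply: sub; apply: subset_closure.
have dphi x : derivable phi x 1 by exact: (sphi 0%N).
have cdphi : continuous (derive1 phi).
  move=> x; apply: differentiable_continuous; apply/derivable1_diffP.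
  exact: (sphi 1%N x).
have prim a : a \in s -> primitive a (e a) phi (derive1 phi).
  by move=> as_; exact: (primitive_C1 (comp_lt Om_comp as_) dphi cdphi).
have E (a : R) (as_ : a \in s) : \int[mu]_(x in `[a, e a]) (derive1 phi x * psi_ a x) =
    - \int[mu]_(x in `[a, e a]) (dpsi x * phi x).
  have := primitive_by_parts (ltW (comp_lt Om_comp as_)) (prim a as_) (H a as_).
  by have [-> ->] := ephi a as_; rewrite !mul0r subr0 sub0r.
have i1 : mu.-integrable Om (EFin \o (fun x => piecewise s e psi_ x * derive1 phi x)).
  apply: integrable_components => a as_.
  have ae_ := ltW (comp_lt Om_comp as_).
  have [idphi _] := prim a as_.
  apply: eq_integrable (primitive_integrableM ae_ (H a as_) idphi) => //.
  by move=> x; rewrite mem_itvcc => xa /=; rewrite (piecewiseE Om_comp _ as_ xa) mulrC.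
have i2 : mu.-integrable Om (EFin \o (fun x => dpsi x * phi x)).
  apply: integrable_components => a as_.
  have ae_ := ltW (comp_lt Om_comp as_).
  have [idpsi _] := H a as_.
  exact: (primitive_integrableM ae_ (prim a as_) idpsi).
rewrite /pairing /Vol1 (Rintegral_components Om_comp i1) (Rintegral_components Om_comp i2).
rewrite -sumrN big_seq [RHS]big_seq; apply: eq_bigr => a as_.
rewrite -E//; apply: eq_Rintegral => x; rewrite mem_itvcc => xa.
by rewrite (piecewiseE Om_comp _ as_ xa) mulrC.
Qed.

Lemma trace_piecewise (psi_ : R -> R -> R) :
  (forall a, a \in s -> {within `[a, e a], continuous (psi_ a)}) ->
  is_trace Om (piecewise s e psi_) (piecewise s e psi_).
Proof.
move=> H; exists (piecewise s e psi_); split => //.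
- exact: (continuous_piecewise Om_comp).
- exact: aeW.
Qed.

Lemma mean_piecewise (p : R) (psi_ : R -> R -> R) : 1 <= p ->
  Lp Vol1 Om p (piecewise s e psi_) ->
  \int[Vol1]_(x in Om) piecewise s e psi_ x = \sum_(a <- s) \int[mu]_(x in `[a, e a]) psi_ a x.
Proof.
move=> p1 L; rewrite /Vol1 (Rintegral_components Om_comp (Lp_integrable mO Ofin p1 L)).
rewrite big_seq [RHS]big_seq; apply: eq_bigr => a as_.
by apply: eq_Rintegral => x; rewrite mem_itvcc => xa; exact: (piecewiseE Om_comp _ as_ xa).
Qed.

Variables (Sv Sp : set R).
Hypotheses (Sv_sub : Sv `<=` boundary Om) (Sp_sub : Sp `<=` boundary Om)
  (boundary_sub : boundary Om `<=` Sv `|` Sp) (SvSp : Sv `&` Sp = set0).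

Lemma boundary_ends : boundary Om `<=` [set` s ++ map e s].
Proof.
move=> x /(comp_boundary Om_comp)[a as_ [->|->]] /=; rewrite mem_cat ?as_//.
by rewrite map_f ?orbT.
Qed.

(** Disjoint closures keep the ends distinct, so the counting integral over [Sv] counts each end
    once. *)
Lemma ends_uniq : uniq (s ++ map e s).
Proof.
have su := comp_uniq Om_comp.
rewrite cat_uniq su/=; apply/andP; split.
  apply/hasPn => _ /mapP[a as_ ->]; apply/negP => es.
  have aea := comp_lt Om_comp as_.
  by have := comp_sep Om_comp as_ es aea; rewrite ltxx.
rewrite map_inj_in_uniq// => a b as_ bs eab.
apply: (left_end_uniq Om_comp as_ bs (x := e a)).
  by rewrite lexx (ltW (comp_lt Om_comp as_)).
by rewrite eab lexx (ltW (comp_lt Om_comp bs)).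
Qed.

Lemma Sp_finite : finite_set Sp.
Proof. by apply: sub_finite_set (subset_trans Sp_sub boundary_ends) _; exact: finite_seq. Qed.

Lemma Rintegral_ends f : \int[Vol0]_(x in Sv) f x =
  \sum_(a <- s) ((if a \in Sv then f a else 0) + (if e a \in Sv then f (e a) else 0)).
Proof.
rewrite (Rintegral_counting f ends_uniq (subset_trans Sv_sub boundary_ends)).
by rewrite big_cat/= big_map big_split.
Qed.

Lemma end_Sv x : boundary Om x -> (x \in Sv) = (x \notin Sp).
Proof.
move=> bx; apply/idP/idP => [xv|xp].
  apply/negP; rewrite inE => xp; rewrite inE in xv.
  by have : (Sv `&` Sp) x by []; rewrite SvSp.
rewrite inE; have [//|xp'] := boundary_sub bx.
by move/negP: xp; case; rewrite inE.
Qed.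

Lemma end_boundary a : a \in s -> boundary Om a /\ boundary Om (e a).
Proof. by move=> as_; split; apply/(comp_boundary Om_comp); exists a => //; [left|right]. Qed.

(* The indicator of a component is a weakly differentiable function with zero
   derivative, so the norm hypothesis rules out such functions in the space. *)
Lemma locally_constant_eq0 (p : R) : 1 <= p ->
  (forall psi dpsi : R -> R, W10 Om Sp p psi ->
      sobolev_deriv Om p psi dpsi -> Lpnorm Om p dpsi = 0%E ->
      {ae (@Vol1 R), forall x, Om x -> psi x = 0}) ->
  forall k : R -> R,
  (Sp = set0 -> \sum_(a <- s) k a * (e a - a) = 0) ->
  (forall a, a \in s -> (a \in Sp) || (e a \in Sp) -> k a = 0) ->
  forall a, a \in s -> k a = 0.
Proof.
move=> p1 W k k0 kSp a as_.
pose psi_ (b x : R) := k b.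
have prim b : b \in s -> primitive b (e b) (psi_ b) (cst 0).
  move=> bs; split; first exact: integrable0.
  by move=> x _; rewrite /Rintegral integral0 addr0.
have L0 : Lp Vol1 Om p (cst 0 : R -> R).
  apply: (@bounded_Lp _ _ _ 0) => //; first exact: lt_le_trans p1.
  by move=> x _; rewrite normr0.
have sob := sobolev_piecewise p1 L0 prim.
have [psiL _ _] := sob.
have Wpsi : W10 Om Sp p (piecewise s e psi_).
  split; first by exists (cst 0).
  - move=> /eqP; rewrite Vol0_eq0; last exact: Sp_finite.
    move=> /eqP S0; rewrite (mean_piecewise p1 psiL).
    rewrite big_seq (eq_bigr (fun a => k a * (e a - a))); last first.
      by move=> b bs; rewrite Rintegral_cst_cc//; exact: (comp_lt Om_comp bs).
    by rewrite -big_seq k0 ?mulr0.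
  - move=> _; exists (piecewise s e psi_).
      apply: trace_piecewise => b bs; exact: continuous_subspaceT (@cst_continuous _ _ _).
    move=> x Sx; have [b bs xE] := (comp_boundary Om_comp x).1 (Sp_sub Sx).
    have xb : b <= x <= e b by have := ltW (comp_lt Om_comp bs); case: xE => -> ->;
      rewrite lexx.
    rewrite (piecewiseE Om_comp _ bs xb) /psi_ kSp//.
    by case: xE => <-; rewrite [x \in Sp]mem_set// orbT.
have N0 : Lpnorm Om p (cst 0 : R -> R) = 0%E.
  rewrite /Lpnorm (_ : EFin \o _ = cst 0%E).
    by apply: Lnorm0; rewrite eqe gt_eqF// (lt_le_trans ltr01).
  by apply/funext => x; rewrite /= patchE; case: ifP.
have ae0 := W _ _ Wpsi sob N0.
have [x xa E] : exists2 x, a < x < e a & piecewise s e psi_ x = 0.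
  apply: ae_point; first exact: (comp_lt Om_comp as_).
  by apply: (ae_mono ae0) => x H xI; apply: H; exact: (component_sub Om_comp as_ xI).
by move: E; rewrite (piecewiseE Om_comp _ as_)//; case/andP: xa => ? ?; rewrite !ltW.
Qed.

End PiecewiseSobolev.

(** * Assembly of the global solution *)

Lemma LpB (R : realType) (mu : {measure set (measurableTypeR R) -> \bar R})
    (A : set R) (p : R) (f g : R -> R) : 1 <= p ->
  Lp mu A p f -> Lp mu A p g -> Lp mu A p (fun x => f x - g x).
Proof.
move=> p1 fL gL; have p1' : (1 <= p%:E)%E by rewrite lee_fin.
rewrite /Lp; have -> : (fun x => f x - g x) \_ A = f \_ A - g \_ A.
  apply/funext => x; rewrite !fctE !patchE; case: ifP => // _.
  by rewrite subrr.
by have [_ LD] := Lfun_addr_closed mu p1'; exact: LD fL (Lfun_oppr_closed gL).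
Qed.

Theorem corollary4p5 (R : realType)
    (Om Sv Sp : set R)
    (Om_open : open Om) (Om_bounded : bounded_set Om)
    (Om_lipschitz : lipschitz_boundary Om)
    (Sv_open : relatively_open Sv (boundary Om))
    (Sp_open : relatively_open Sp (boundary Om))
    (boundary_cover : boundary Om = closure (Sv `|` Sp))
    (boundary_disjoint : Sv `&` Sp = set0)
    (r s : R) (r_ge2 : 2 <= r) (s_def : s = r / (r - 1))
    (* psi |-> ||psi'||_s is a norm on W_0^{1,s} *)
    (W10_normed : forall psi dpsi : R -> R, W10 Om Sp s psi ->
      sobolev_deriv Om s psi dpsi -> Lpnorm Om s dpsi = 0%E ->
      {ae (@Vol1 R), forall x, Om x -> psi x = 0})
    (q f u0 p0 : R -> R)
    (q_Lr : Lp Vol1 Om r q) (f_Ls : Lp Vol1 Om s f)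
    (u0_Lr : Lp Vol0 Sv r u0) (p0_W : Wfrac Sp r^-1 s p0)
    (E : (R -> R) -> R -> R) (dEp0 : R -> R)
    (E_ext : (0 < @Vol0 R Sp)%E -> extension_operator Om Sp r s E)
    (dEp0_deriv : (0 < @Vol0 R Sp)%E -> sobolev_deriv Om s (E p0) dEp0)
    (D : R -> R) (Phi : R -> set R) (Psi : R -> R)
    (drag_op : dissipative_drag Om r s D Phi Psi) :
  exists u p dp : R -> R,
    [/\ Lp Vol1 Om r u, W10 Om Sp s p, sobolev_deriv Om s p dp &
     exists2 lam : R -> R, drag D Phi Om s u lam &
       (forall phi : R -> R, Lp Vol1 Om r phi ->
          pairing Om lam phi
          = pairing Om (fun x => - dp x + forcing Sp f dEp0 x) phi) /\
       (forall psi dpsi tau : R -> R, W10 Om Sp s psi ->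
          sobolev_deriv Om s psi dpsi -> is_trace Om psi tau ->
          pairing Om dpsi u
          = - (\int[Vol1]_(x in Om) (q x * psi x))
            + \int[Vol0]_(x in Sv) (u0 x * tau x))].
Proof.
have s_ge1 : 1 <= s by rewrite s_def ler_pdivlMr ?subr_gt0; lra.
have s_gt0 : 0 < s by exact: lt_le_trans s_ge1.
have r_gt0 : 0 < r by exact: lt_le_trans r_ge2.
have [t [e comp]] := lipschitz_components Om_open Om_bounded Om_lipschitz.
have mO : measurable (Om : set (measurableTypeR R)) by exact: measurable_components comp.
have Ofin := components_finite_measure comp.
have Sv_sub : Sv `<=` boundary Om by case: Sv_open => U _ -> x [].
have Sp_sub : Sp `<=` boundary Om by case: Sp_open => U _ -> x [].
have Sp_fin := Sp_finite comp Sp_sub.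
(* The boundary is finite, so the union of [Sv] and [Sp] is closed and equals its closure. *)
have boundary_sub : boundary Om `<=` Sv `|` Sp.
  rewrite boundary_cover => x; rewrite -(closure_id _).1//.
  apply: (accessible_finite_set_closed.1 _); last first.
    apply: sub_finite_set (subset_trans _ (boundary_ends comp)) (finite_seq _).
    by move=> y [/Sv_sub|/Sp_sub].
  by apply: hausdorff_accessible; exact: Rhausdorff.
have SpE : (@Vol0 R Sp == 0%E) = (Sp == set0) by exact: Vol0_eq0.
have Sp_gt0 : Sp != set0 -> (0 < @Vol0 R Sp)%E.
  by move=> S0; rewrite lt_neqAle eq_sym SpE S0 measure_ge0.
pose F := forcing Sp f dEp0.
have FL : Lp Vol1 Om s F.
  rewrite /F /forcing; case: ifPn => // S0.
  have S1 : Sp != set0 by rewrite -SpE.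
  have [_ dL _] := dEp0_deriv (Sp_gt0 S1).
  exact: LpB.
have r_ge1 : 1 <= r by apply: le_trans r_ge2; rewrite ler1n.
have iq := Lp_integrable mO Ofin r_ge1 q_Lr.
have iF := Lp_integrable mO Ofin s_ge1 FL.
have mI a : measurable (`]a, e a[%classic : set (measurableTypeR R)) by exact: measurable_itv.
have icc g a : a \in t -> lebesgue_measure.-integrable (Om : set (measurableTypeR R)) (EFin \o g) ->
    lebesgue_measure.-integrable `[a, e a] (EFin \o g).
  move=> at_ ig; apply: integrable_oo_cc.
  exact: (integrableS mO (mI a) (component_sub comp at_) ig).
have [lcst0 lcst1] : (Sp != set0 -> forall a, a \in t -> (a \in Sp) || (e a \in Sp)) /\
    (Sp = set0 -> forall a b, a \in t -> b \in t -> a = b).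
  have K := locally_constant_eq0 Om_open comp Sp_sub s_ge1 W10_normed.
  split => [S0 a at_|S0 a b at_ bt].
    apply: contrapT => /negP nS.
    have K1 : (a == a)%:R = 0 :> R.
      (* The indicator of a component with no end in [Sp] would be a nonzero function of zero
         norm. *)
      apply: (K (fun b => (b == a)%:R)) => // [SpS|b bt bS].
        by move: S0; rewrite SpS eqxx.
      by case: eqP => // ba; move: nS; rewrite -ba bS.
    by move/eqP: K1; rewrite eqxx oner_eq0.
  apply/eqP; apply: contrapT => /negP ab.
  (* Weighting each of two components by the length of the other, with opposite signs, gives a
     locally constant function of mean zero. *)
  pose k c : R := (c == a)%:R * (e b - b) - (c == b)%:R * (e a - a).
  have sumE (g : R -> R) c : c \in t -> \sum_(x <- t) (x == c)%:R * g x = g c.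
    move=> ct; rewrite (bigD1_seq c)//=; last exact: comp_uniq comp.
    by rewrite eqxx mul1r big1 ?addr0// => x /negbTE ->; rewrite mul0r.
  suff K1 : k a = 0.
    move/eqP: K1; rewrite /k eqxx (negbTE ab) mul1r mul0r subr0 subr_eq0.
    by rewrite gt_eqF//; exact: (comp_lt comp bt).
  apply: (K k) => // [_|c _]; last by rewrite S0 !in_set0.
  transitivity (\sum_(x <- t) ((x == a)%:R * ((e b - b) * (e x - x))
      - (x == b)%:R * ((e a - a) * (e x - x)))).
    by apply: eq_bigr => x _; rewrite mulrBl -!mulrA.
  by rewrite sumrB (sumE (fun x => (e b - b) * (e x - x)) a)// (sumE (fun x => (e a - a) * (e x - x)) b)//; ring.
(* The tuple holds velocity, drag, pressure and k. The sign of u0 at a left end is that of the outer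
   normal there. *)
have prob a : exists w : (R -> R) * (R -> R) * (R -> R) * R, a \in t ->
  [/\ [/\ primitive a (e a) w.1.1.1 (fun x => q x + w.2),
          (a \in Sp) || (e a \in Sp) -> w.2 = 0,
          a \notin Sp -> w.1.1.1 a = - u0 a & e a \notin Sp -> w.1.1.1 (e a) = u0 (e a)],
      drag D Phi `]a, e a[ s w.1.1.1 w.1.1.2,
      primitive a (e a) w.1.2 (fun x => F x - w.1.1.2 x) &
      [/\ a \in Sp -> w.1.2 a = 0, e a \in Sp -> w.1.2 (e a) = 0 &
          ~~ ((a \in Sp) || (e a \in Sp)) -> \int[lebesgue_measure]_(x in `[a, e a]) w.1.2 x = 0]].
  have [at_|nat_] := boolP (a \in t); last by exists (cst 0, cst 0, cst 0, 0).
  have [u [lam [P [k H]]]] := component_problem mO Ofin r_ge2 s_gt0 drag_op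
    (a \in Sp) (e a \in Sp) (- u0 a) (u0 (e a)) (comp_lt comp at_) (component_sub comp at_)
    (icc _ _ at_ iq) (icc _ _ at_ iF).
  by exists (u, lam, P, k).
have [w Hw] := choice prob.
pose u := piecewise t e (fun a => (w a).1.1.1).
pose lam := piecewise t e (fun a => (w a).1.1.2).
pose P := piecewise t e (fun a => (w a).1.2).
pose dP x := F x - lam x.
have lamL : Lp Vol1 Om s lam.
  by apply: (Lp_piecewise comp s_ge1) => a at_; have [_ [L _] _ _] := Hw a at_.
have dPL : Lp Vol1 Om s dP by exact: LpB.
have uL : Lp Vol1 Om r u.
  apply: (Lp_piecewise comp r_ge1) => a at_; have [[pu _ _ _] _ _ _] := Hw a at_.
  have ae_ := ltW (comp_lt comp at_).
  have [M HM] := primitive_bounded ae_ pu.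
  apply: (@bounded_Lp _ _ _ M) => //.
  - exact: lebesgue_measure_oo_fin.
  - by apply: measurable_funS (primitive_mfun ae_ pu) => //; exact: subset_itv_oo_cc.
  - by move=> x /=; rewrite in_itv/= => /andP[ax xa]; apply: HM; rewrite !ltW.
have primP a : a \in t -> primitive a (e a) (w a).1.2 dP.
  move=> at_; have [_ _ pP _] := Hw a at_; apply: eq_primitive pP => x xa.
  by rewrite /dP /lam (piecewiseE comp _ at_ xa).
have sobP : sobolev_deriv Om s P dP by exact: (sobolev_piecewise Om_open comp).
have [PL _ _] := sobP.
have WP : W10 Om Sp s P.
  split; first by exists dP.
  - move=> /eqP; rewrite SpE => /eqP S0; rewrite (mean_piecewise comp s_ge1 PL).
    rewrite big_seq big1 ?mulr0// => a at_; have [_ _ _ [_ _]] := Hw a at_.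
    by apply; rewrite S0 !in_set0.
  - move=> _; exists P.
      apply: (trace_piecewise comp) => a at_.
      exact: (primitive_continuous (ltW (comp_lt comp at_)) (primP a at_)).
    move=> x Sx; have [a at_ xE] := (comp_boundary comp x).1 (Sp_sub x Sx).
    have ae_ := ltW (comp_lt comp at_).
    have xa : a <= x <= e a by case: xE => -> ; rewrite lexx ?ae_.
    have [_ _ _ [Pa Pe _]] := Hw a at_.
    rewrite /P (piecewiseE comp _ at_ xa).
    by case: xE => E1; rewrite E1; [apply: Pa|apply: Pe]; rewrite -E1 inE.
exists u, P, dP; split => //.
exists lam.
  split => //; apply: (ae_components comp) => a at_.
  have [_ [_ al] _ _] := Hw a at_.
  apply: (ae_mono al) => x H xa.
  have xa' : a <= x <= e a by move: xa; rewrite /= in_itv/= => /andP[? ?]; rewrite !ltW.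
  by rewrite /u /lam !(piecewiseE comp _ at_ xa'); exact: H.
split.
  (* Since [dP] is F - lam by definition, the two integrands coincide at every point. *)
  move=> phi _; congr (Rintegral _ _ _); apply/funext => x.
  by rewrite -/F /dP opprB addrNK.
move=> psi dpsi tau Wpsi sob [h [hc psih tauh]].
have [psiL dpsiL _] := sob.
have sub a : a \in t -> `[a, e a] `<=` closure Om.
  move=> at_ x /=; rewrite in_itv/= => /andP[ax xa].
  have [bda bde] := end_boundary comp at_.
  move: ax; rewrite le_eqVlt => /predU1P[<-|ax]; first by case: bda.
  move: xa; rewrite le_eqVlt => /predU1P[->|xa]; first by case: bde.
  by apply: subset_closure; apply: (component_sub comp at_); rewrite /= in_itv/= ax.
have primh a : a \in t -> primitive a (e a) h dpsi.
  move=> at_; apply: (sobolev_primitive mO Ofin s_ge1 (comp_lt comp at_) (component_sub comp at_) _ psih sob).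
  exact: continuous_subspaceW (sub a at_) hc.
(* Membership in [W10] supplies a vanishing trace through its own representative h', which has to be
   identified with h. *)
have h0 x : Sp x -> h x = 0.
  move=> Sx; have S0 : Sp != set0 by apply/set0P; exists x.
  case: Wpsi => _ _ /(_ (Sp_gt0 S0))[tau' [h' [hc' psih' tauh']] tau0].
  have bx := Sp_sub x Sx.
  rewrite -(tau0 x Sx) tauh'//.
  have [a at_ xE] := (comp_boundary comp x).1 bx.
  have ab := comp_lt comp at_.
  have primh' : primitive a (e a) h' dpsi.
    apply: (sobolev_primitive mO Ofin s_ge1 ab (component_sub comp at_) _ psih' sob).
    exact: continuous_subspaceW (sub a at_) hc'.
  apply: (trace_eq ab (primh a at_) primh' (psi := psi)).
  - by apply: (ae_mono psih) => y H /(component_sub comp at_).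
  - by apply: (ae_mono psih') => y H /(component_sub comp at_).
  - by case: xE => ->; rewrite lexx ltW.
have ih a (at_ : a \in t) : lebesgue_measure.-integrable `[a, e a] (EFin \o h).
  exact: (continuous_compact_integrable (@segment_compact R _ _) (primitive_continuous (ltW (comp_lt comp at_)) (primh a at_))).
have iqh a (at_ : a \in t) := primitive_integrableM (ltW (comp_lt comp at_)) (primh a at_) (icc _ _ at_ iq).
have parts a : a \in t -> \int[lebesgue_measure]_(x in `[a, e a]) (dpsi x * u x) =
   (if a \in Sv then u0 a * tau a else 0) + (if e a \in Sv then u0 (e a) * tau (e a) else 0)
   - \int[lebesgue_measure]_(x in `[a, e a]) (q x * h x)
   - (w a).2 * \int[lebesgue_measure]_(x in `[a, e a]) h x.
  move=> at_; have [[pu _ ua ub] _ _ _] := Hw a at_.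
  have ae_ := ltW (comp_lt comp at_).
  have [bda bde] := end_boundary comp at_.
  transitivity (\int[lebesgue_measure]_(x in `[a, e a]) (dpsi x * (w a).1.1.1 x)).
    by apply: eq_Rintegral => x; rewrite mem_itvcc => xa; rewrite /u (piecewiseE comp _ at_ xa).
  rewrite (primitive_by_parts ae_ (primh a at_) pu).
  have -> : \int[lebesgue_measure]_(x in `[a, e a]) ((q x + (w a).2) * h x) =
      \int[lebesgue_measure]_(x in `[a, e a]) (q x * h x)
      + (w a).2 * \int[lebesgue_measure]_(x in `[a, e a]) h x.
    rewrite -RintegralZl//; last exact: ih.
    rewrite -RintegralD//; last 2 first.
    - exact: iqh.
    - apply: (integrable_ext (integrable_scaler (w a).2 _ (ih a at_))) => // x; exact: mulrC.
    by apply: eq_Rintegral => x _; rewrite mulrDl.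
  (* At an end in [Sp] the test function vanishes. At an end in [Sv] the sign of u cancels that of
     the boundary term, so both ends contribute u0 times the trace. *)
  rewrite !(end_Sv boundary_sub boundary_disjoint)// !tauh// opprD addrA; congr (_ - _ - _).
  have -> : h (e a) * (w a).1.1.1 (e a) = if e a \notin Sp then u0 (e a) * h (e a) else 0.
    case: ifPn => [/ub ->|]; first by rewrite mulrC.
    by rewrite negbK inE => /h0 ->; rewrite mul0r.
  have -> : h a * (w a).1.1.1 a = - (if a \notin Sp then u0 a * h a else 0).
    case: ifPn => [/ua ->|]; first by rewrite mulrN mulrC.
    by rewrite negbK inE => /h0 ->; rewrite mul0r oppr0.
  by rewrite opprK addrC.
have iu : lebesgue_measure.-integrable (Om : set (measurableTypeR R)) (EFin \o (fun x => dpsi x * u x)).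
  apply: (integrable_components comp) => a at_; have [[pu _ _ _] _ _ _] := Hw a at_.
  have [idpsi _] := primh a at_.
  apply: eq_integrable (primitive_integrableM (ltW (comp_lt comp at_)) pu idpsi) => //.
  by move=> x; rewrite mem_itvcc => xa /=; rewrite /u (piecewiseE comp _ at_ xa).
have ihO : lebesgue_measure.-integrable (Om : set (measurableTypeR R)) (EFin \o h).
  by apply: (integrable_components comp).
have iqhO : lebesgue_measure.-integrable (Om : set (measurableTypeR R)) (EFin \o (fun x => q x * h x)).
  by apply: (integrable_components comp).
have mpsi := Lp_mfun mO psiL.
have qpsi : \int[Vol1]_(x in Om) (q x * psi x) = \sum_(a <- t) \int[lebesgue_measure]_(x in `[a, e a]) (q x * h x).
  rewrite -(Rintegral_components comp iqhO) /Vol1.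
  apply: (eq_Rintegral_ae mO) => //.
  - by apply: measurable_funM => //; exact: integrable_mfun iq.
  - exact: integrable_mfun iqhO.
  - by apply: (ae_mono psih) => x H Ox; rewrite H.
(* If [Sp] is nonempty, every component has an end in it and its constant is 0. If [Sp] is empty,
   there is at most one component, and the test function has mean zero over it. *)
have zero : \sum_(a <- t) (w a).2 * \int[lebesgue_measure]_(x in `[a, e a]) h x = 0.
  have [S0|S0] := eqVneq Sp set0; last first.
    rewrite big_seq big1// => a at_; have [[_ k0 _ _] _ _ _] := Hw a at_.
    by rewrite k0 ?mul0r//; exact: lcst0.
  case Et : t => [|a t']; first by rewrite big_nil.
  have at_ : a \in t by rewrite Et mem_head.
  rewrite -Et big_seq (eq_bigr (fun b => (w a).2 * \int[lebesgue_measure]_(x in `[b, e b]) h x)); last first.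
    by move=> b bt; rewrite (lcst1 S0 a b).
  rewrite -big_seq -mulr_sumr -(Rintegral_components comp ihO).
  have V0 : @Vol0 R Sp = 0%E by apply/eqP; rewrite SpE S0.
  case: Wpsi => _ /(_ V0) + _.
  have -> : \int[Vol1]_(x in Om) psi x = \int[lebesgue_measure]_(x in Om) h x.
    by rewrite /Vol1; apply: (eq_Rintegral_ae mO) => //; exact: integrable_mfun ihO.
  move/eqP; rewrite mulf_eq0 => /orP[|/eqP ->]; last by rewrite mulr0.
  rewrite invr_eq0 gt_eqF// fine_gt0//; apply/andP; split; last exact: Ofin.
  apply: (@lt_le_trans _ _ (lebesgue_measure (`]a, e a[%classic : set R))).
    by rewrite lebesgue_measure_oo ?lte_fin ?subr_gt0; exact: (comp_lt comp at_).
  by apply: le_measure; rewrite ?inE//; exact: (component_sub comp at_).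
rewrite /pairing /Vol1 (Rintegral_components comp iu) -/Vol1 qpsi.
rewrite (Rintegral_ends comp Sv_sub) big_seq (eq_bigr _ parts) -big_seq.
by rewrite !sumrB zero subr0 addrC.
Qed.
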